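(* Let $w$ be a positive $2\pi$-periodic weight for which the trigonometric system $\mathcal{T}=\{e_{n_k}\}_{k=1}^\infty$ is a quasi-greedy basis for $L^2(\mathbb{T};w)$. Then $\mathcal{T}$ is a Riesz basis for $L^2(\mathbb{T};w)$.
   Context: Let $\mathbb{T}=[-\pi,\pi)$. A $2\pi$-periodic weight is a measurable $2\pi$-periodic function $w$ on $\mathbb{R}$ with values in $[0,\infty]$. $L^2(\mathbb{T};w)$ is the space of measurable functions $f:\mathbb{T}\to\mathbb{C}$ (modulo equality a.e. with respect to $w\,dt$) with $\|f\|_{2,w}^2=\int_{-\pi}^{\pi}|f(t)|^2 w(t)\,dt<\infty$. Trigonometric system: $e_k(t)=(2\pi)^{-1/2}e^{ikt}$, $k\in\mathbb{Z}$, and $\mathcal{T}=\{e_{n_k}\}_{k=1}^\infty$ is this system in the ordering $\{n_k\}_{k=1}^\infty=\{0,-1,1,-2,2,\ldots\}$. Quasi-greedy basis: Let $\{b_k\}_{k\in\mathbb{N}}$ be a bounded Schauder basis of a Banach space $X$, i.e., a Schauder basis (in the given order) with $0<\inf_k\|b_k\|_X\le\sup_k\|b_k\|_X<\infty$, and let $\{b_k^*\}$ be its dual (biorthogonal) system. For $x\in X$ the greedy ordering is the map $\rho:\mathbb{N}\to\mathbb{N}$ with $\rho(\mathbb{N})\supseteq\{j: b_j^*(x)\neq0\}$ such that for $j<k$ either $|b^*_{\rho(k)}(x)|<|b^*_{\rho(j)}(x)|$, or $|b^*_{\rho(k)}(x)|=|b^*_{\rho(j)}(x)|$ and $\rho(k)>\rho(j)$.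 The greedy $m$-term approximant is $\mathcal{G}_m(x)=\sum_{j=1}^m b^*_{\rho(j)}(x)\,b_{\rho(j)}$. The basis is called quasi-greedy if $\lim_{m\to\infty}\|x-\mathcal{G}_m(x)\|_X=0$ for every $x\in X$. Riesz basis: a sequence with dense linear span for which there are constants $0<A\le B<\infty$ such that $A\sum_k|a_k|^2\le\|\sum_k a_k e_{n_k}\|_{2,w}^2\le B\sum_k|a_k|^2$ for all finite scalar sequences $\{a_k\}$. *)

(* Defs.v *)
From HB Require Import structures.
From mathcomp Require Import all_boot all_order all_algebra.
From mathcomp Require Import ring lra complex ring_quotient.
From mathcomp Require Import all_classical all_reals all_analysis measurable_realfun.

Set Implicit Arguments.
Unset Strict Implicit.
Unset Printing Implicit Defensive.

Import Order.TTheory GRing.Theory Num.Theory.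
Import numFieldNormedType.Exports.
Import ComplexField.Normc.

Local Open Scope classical_set_scope.
Local Open Scope complex_scope.
Local Open Scope ring_scope.

Definition circle (R : realType) : set R := `[- pi, pi[.

Record weight (R : realType) := Weight {
  weight_fun :> R -> \bar R ;
  weight_measurable : measurable_fun setT weight_fun ;
  weight_ge0 : forall t, (0 <= weight_fun t)%E ;
  weight_periodic : forall t, weight_fun (t + 2 * pi) = weight_fun t }.

Lemma minkowski_of_young (R : realFieldType) (a b x : R) :
  0 <= a -> 0 <= b -> 0 <= x ->
  (forall e, 0 < e -> x ^+ 2 <= (1 + e) * a ^+ 2 + (1 + e^-1) * b ^+ 2) ->
  x <= a + b.
Proof.
move=> a0 b0 x0 H; apply/ler_addgt0Pr => d d0.
have ad : 0 < a + d / 2 by lra.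
have bd : 0 < b + d / 2 by lra.
have c0 : 0 <= a + b + d by lra.
rewrite -(@ler_pXn2r _ 2 isT _ _ x0 c0).
have e0 : 0 < (b + d / 2) / (a + d / 2) by rewrite divr_gt0.
apply: le_trans (H _ e0) _; rewrite invf_div.
have aA : a ^+ 2 <= (a + d / 2) ^+ 2 by nra.
have bB : b ^+ 2 <= (b + d / 2) ^+ 2 by nra.
have -> : a + b + d = (a + d / 2) + (b + d / 2) by lra.
move: (a + d / 2) (b + d / 2) ad bd e0 aA bB => A B A0 B0 e0 aA bB.
have -> : (A + B) ^+ 2 = (1 + B / A) * A ^+ 2 + (1 + A / B) * B ^+ 2.
  by field; rewrite !gt_eqF.
have e0' : 0 < A / B by rewrite divr_gt0.
by apply: lerD; apply: ler_wpM2l => //; apply: addr_ge0 => //; exact: ltW.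
Qed.

Section weighted_measure.
Context (R : realType) (w : weight R).
Local Open Scope ereal_scope.

(* The measure w(t) dt on [-pi, pi[, extended by 0 outside. *)
Definition wdt (A : set R) : \bar R :=
  \int[lebesgue_measure]_(t in A `&` @circle R) w t.

Lemma wdtE A : wdt A = \int[lebesgue_measure]_(t in A) (w \_ (@circle R)) t.
Proof. by rewrite /wdt integral_mkcondr. Qed.

Lemma measurable_circle : measurable (@circle R).
Proof. exact: measurable_itv. Qed.

Let wdt0 : wdt set0 = 0. Proof. by rewrite wdtE integral_set0. Qed.

Let wdt_ge0 A : 0 <= wdt A.
Proof. by apply: integral_ge0 => t _; exact: weight_ge0. Qed.

Let wdt_sigma_additive : semi_sigma_additive wdt.
Proof.
rewrite (_ : wdt = fun A => \int[lebesgue_measure]_(t in A) (w \_ (@circle R)) t);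
  last by apply/funext => A; exact: wdtE.
apply: (@semi_sigma_additive_nng_induced _ _ _ lebesgue_measure) => [|t].
  apply/(measurable_restrictT _ measurable_circle).
  exact: measurable_funTS (weight_measurable w).
by rewrite patchE; case: ifPn => // _; exact: weight_ge0.
Qed.

HB.instance Definition _ := isMeasure.Build _ _ _ wdt
  wdt0 wdt_ge0 wdt_sigma_additive.

End weighted_measure.

Section L2_functions.
Context (R : realType) (w : weight R).
Local Notation C := (R[i]^o).
Implicit Types f g : R -> C.

(* Complex functions on [-pi, pi[ are represented by functions on the whole
   line; every notion below (measurability, norm, equality almost everywhere)
   ignores the values outside [-pi, pi[. *)
Definition energy f : \bar R :=
  (\int[lebesgue_measure]_(t in @circle R) ((normc (f t) ^+ 2)%:E * w t))%E.

Definition measurable_complex f :=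
  measurable_fun (@circle R) (fun t => complex.Re (f t)) /\
  measurable_fun (@circle R) (fun t => complex.Im (f t)).

Definition inL2 : {pred R -> C} :=
  mem [set f | measurable_complex f /\ (energy f < +oo)%E].

Lemma normc_sq (z : R[i]) :
  normc z ^+ 2 = complex.Re z ^+ 2 + complex.Im z ^+ 2.
Proof. by case: z => a b /=; rewrite sqr_sqrtr// addr_ge0// sqr_ge0. Qed.

Let mE f : measurable_complex f ->
  measurable_fun (@circle R) (fun t => ((normc (f t) ^+ 2)%:E * w t)%E).
Proof.
move=> [mr mi]; apply: emeasurable_funM; last first.
  exact: measurable_funTS (weight_measurable w).
apply/measurable_EFinP; under eq_fun do rewrite normc_sq.
by apply: measurable_funD; exact: measurable_funX.
Qed.

Let E0 f t : (0 <= (normc (f t) ^+ 2)%:E * w t)%E.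
Proof. by rewrite mule_ge0 ?lee_fin ?sqr_ge0 ?weight_ge0. Qed.

Lemma energy_ge0 f : (0 <= energy f)%E.
Proof. exact: integral_ge0. Qed.

Lemma measurable_complexD f g : measurable_complex f -> measurable_complex g ->
  measurable_complex (f + g).
Proof.
move=> [fr fi] [gr gi]; split.
  apply: (eq_measurable_fun (fun t => complex.Re (f t) + complex.Re (g t))).
    by move=> t _; rewrite fctE; case: (f t) (g t) => ? ? [].
  exact: measurable_funD.
apply: (eq_measurable_fun (fun t => complex.Im (f t) + complex.Im (g t))).
  by move=> t _; rewrite fctE; case: (f t) (g t) => ? ? [].
exact: measurable_funD.
Qed.

Lemma measurable_complexZ (a : R[i]) f : measurable_complex f ->
  measurable_complex (a *: f).
Proof.
case: a => a b [fr fi]; split.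
  apply: (eq_measurable_fun
      (fun t => a * complex.Re (f t) - b * complex.Im (f t))).
    by move=> t _; rewrite fctE; case: (f t).
  by apply: measurable_funB; apply: measurable_funM.
apply: (eq_measurable_fun
    (fun t => a * complex.Im (f t) + b * complex.Re (f t))).
  by move=> t _; rewrite fctE; case: (f t).
by apply: measurable_funD; apply: measurable_funM.
Qed.

Lemma energyZ (a : R[i]) f : measurable_complex f ->
  energy (a *: f) = ((normc a ^+ 2)%:E * energy f)%E.
Proof.
move=> mf; rewrite /energy -ge0_integralZl//.
- apply: eq_integral => t _.
  rewrite muleA -EFinM -exprMn fctE; congr ((_ ^+ 2)%:E * _)%E.
  exact: normcM.
- exact: measurable_circle.
- exact: mE.
- by rewrite lee_fin sqr_ge0.
Qed.

Lemma energyD f g (e : R) : measurable_complex f -> measurable_complex g ->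
  0 < e ->
  (energy (f + g)%R <= (1 + e)%:E * energy f + (1 + e^-1)%:E * energy g)%E.
Proof.
move=> mf mg e0.
have ei : 0 < e^-1 by rewrite invr_gt0.
have p1 : (0 <= (1 + e)%:E :> \bar R)%E by rewrite lee_fin; lra.
have p2 : (0 <= (1 + e^-1)%:E :> \bar R)%E by rewrite lee_fin; lra.
have mC := @measurable_circle R.
rewrite /energy -!ge0_integralZl//; [|exact: mE|exact: mE].
rewrite -ge0_integralD//=; [ | | | |].
- apply: ge0_le_integral => //.
  + by apply: mE; exact: measurable_complexD.
  + by apply: emeasurable_funD; apply: emeasurable_funM => //; exact: mE.
  + move=> t _; rewrite !muleA -!EFinM -ge0_muleDl.
    2,3: by rewrite lee_fin mulr_ge0 ?sqr_ge0// addr_ge0// ltW.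
    apply: lee_wpmul2r; first exact: weight_ge0.
    rewrite -EFinD lee_fin !normc_sq.
    rewrite [(f + g) t]/(f t + g t).
    case: (f t) (g t) => a b [c d] /=.
    have H (x y : R) : (x + y) ^+ 2 <= (1 + e) * x ^+ 2 + (1 + e^-1) * y ^+ 2.
      rewrite -subr_ge0 (_ : _ - _ = e^-1 * (e * x - y) ^+ 2).
        by rewrite mulr_ge0// ?sqr_ge0// ltW.
      by field; rewrite gt_eqF.
    have := H a c; have := H b d; lra.
- by move=> t _; rewrite mule_ge0.
- by apply: emeasurable_funM => //; exact: mE.
- by move=> t _; rewrite mule_ge0.
- by apply: emeasurable_funM => //; exact: mE.
Qed.

Lemma inL2P f :
  f \in inL2 <-> measurable_complex f /\ (energy f < +oo)%E.
Proof. by rewrite inE. Qed.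

Lemma inL2_submod_closed : submod_closed inL2.
Proof.
split.
  apply/inL2P; split; first by split; exact: measurable_cst.
  rewrite /energy integral0_eq// => t _.
  by rewrite /= expr0n /= addr0 sqrtr0 expr0n mul0e.
move=> a f g /inL2P[mf Ef] /inL2P[mg Eg]; apply/inL2P.
have mZ := measurable_complexZ a mf.
split; first exact: measurable_complexD.
apply: le_lt_trans (energyD mZ mg (@ltr01 R)) _.
have h : (0 <= (1 + 1)%:E :> \bar R)%E by rewrite lee_fin addr_ge0.
have aEf : (energy (a *: f) < +oo)%E.
  rewrite energyZ //; apply: lte_mul_pinfty Ef => //.
  by rewrite lee_fin sqr_ge0.
by rewrite invr1; apply: lte_add_pinfty; apply: lte_mul_pinfty.
Qed.

HB.instance Definition _ :=
  GRing.isSubmodClosed.Build _ _ inL2 inL2_submod_closed.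

Definition L2fun : Type := {f | f \in inL2}.
HB.instance Definition _ := [isSub of L2fun for @sval _ _].
HB.instance Definition _ := [Choice of L2fun by <:].
HB.instance Definition _ := [SubChoice_isSubLmodule of L2fun by <:].

Definition L2seminorm (f : L2fun) : R := Num.sqrt (fine (energy (val f))).

End L2_functions.

Section L2_space.
Context (R : realType) (w : weight R).
Implicit Types f g : L2fun w.

Lemma L2fun_measurable f : measurable_complex (val f).
Proof. by have /inL2P[] := valP f. Qed.

Lemma energy_fin f : (fine (energy w (val f)))%:E = energy w (val f).
Proof.
by rewrite fineK// ge0_fin_numE ?energy_ge0//; have /inL2P[] := valP f.
Qed.

Lemma L2seminorm_sq f : (L2seminorm f ^+ 2)%:E = energy w (val f).
Proof.
by rewrite /L2seminorm sqr_sqrtr ?energy_fin// fine_ge0 ?energy_ge0.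
Qed.

Lemma L2seminorm_ge0 f : 0 <= L2seminorm f.
Proof. exact: sqrtr_ge0. Qed.

Lemma L2seminormD f g : L2seminorm (f + g) <= L2seminorm f + L2seminorm g.
Proof.
apply: minkowski_of_young; try exact: L2seminorm_ge0.
move=> e e0.
have := energyD w (L2fun_measurable f) (L2fun_measurable g) e0.
rewrite -[val f + val g]/(val (f + g)) -!L2seminorm_sq.
by rewrite -!EFinM -EFinD lee_fin.
Qed.

Lemma L2seminormZ (a : R[i]) f : L2seminorm (a *: f) = normc a * L2seminorm f.
Proof.
have n0 : 0 <= normc a by case: a => x y; exact: sqrtr_ge0.
have := energyZ w a (L2fun_measurable f).
rewrite -[a *: val f]/(val (a *: f)) -!L2seminorm_sq -EFinM -exprMn.
move=> [h].
have q0 : 0 <= normc a * L2seminorm f by exact: mulr_ge0 n0 (L2seminorm_ge0 f).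
by apply/eqP; rewrite -(eqrXn2 (isT : 0 < 2)%N (L2seminorm_ge0 _) q0) h.
Qed.

Definition L2null : {pred L2fun w} :=
  mem [set f | \forall t \ae wdt w, val f t = 0].

Lemma L2nullP f : f \in L2null <-> L2seminorm f = 0.
Proof.
have mC := @measurable_circle R.
have [mr mi] := L2fun_measurable f.
have mw : measurable_fun setT w := weight_measurable w.
pose F t := ((normc (val f t) ^+ 2)%:E * w t)%E.
have mF : measurable_fun (@circle R) F.
  apply: emeasurable_funM; last exact: measurable_funTS.
  apply/measurable_EFinP; under eq_fun do rewrite normc_sq.
  by apply: measurable_funD; exact: measurable_funX.
have F0 t : (0 <= F t)%E by rewrite mule_ge0 ?lee_fin ?sqr_ge0 ?weight_ge0.
have absF : energy w (val f) = (\int[lebesgue_measure]_(t in @circle R) `|F t|)%E.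
  by apply: eq_integral => t _; rewrite gee0_abs.
have absw D : (\int[lebesgue_measure]_(t in D) w t =
    \int[lebesgue_measure]_(t in D) `|w t|)%E.
  by apply: eq_integral => t _; rewrite gee0_abs// weight_ge0.
have normE : L2seminorm f = 0 <-> energy w (val f) = 0%E.
  rewrite -L2seminorm_sq; split => [->|[]]; first by rewrite expr0n.
  by move/eqP; rewrite sqrf_eq0 => /eqP.
rewrite normE absF; split.
  rewrite inE => -[A [mA A0 fA]].
  apply/(@ae_eq_integral_abs _ _ _ lebesgue_measure _ mC _ mF).
  have mAC : measurable (A `&` @circle R) by exact: measurableI.
  have : (\int[lebesgue_measure]_(t in A `&` @circle R) `|w t|)%E = 0%E.
    by rewrite -absw.
  move/(@ae_eq_integral_abs _ _ _ lebesgue_measure _ mAC _ (measurable_funTS mw)).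
  apply: filterS => t wt Ct; rewrite /F.
  have [ft|ft] := eqVneq (val f t) 0.
    by rewrite ft normc0 expr0n mul0e.
  by rewrite wt ?mule0//; split=> //; apply: fA => /=; apply/eqP.
move/(@ae_eq_integral_abs _ _ _ lebesgue_measure _ mC _ mF) => aeF.
rewrite inE /=.
pose g t := complex.Re (val f t) ^+ 2 + complex.Im (val f t) ^+ 2.
have mg : measurable_fun (@circle R) g.
  by apply: measurable_funD; exact: measurable_funX.
pose M := @circle R `&` g @^-1` (~` [set 0]).
have mM : measurable M by apply: mg => //; exact: measurableC.
exists (M `|` ~` @circle R); split.
- by apply: measurableU => //; exact: measurableC.
- rewrite /= /wdt setIUl setICl setU0 (_ : M `&` _ = M); last first.
    by apply/setIidPl => t [].
  rewrite absw; apply/(@ae_eq_integral_abs _ _ _ lebesgue_measure _ mM _ (measurable_funTS mw)).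
  apply: filterS aeF => t Ft [Ct gt].
  have /eqP := Ft Ct; rewrite mule_eq0 eqe normc_sq => /orP[/eqP//|/eqP//].
- move=> t /= ft; have [Ct|] := pselect (@circle R t); [left|by right].
  split=> //= gt; apply: ft; apply: eq0_normc; apply/eqP.
  by rewrite -sqrf_eq0 normc_sq; apply/eqP.
Qed.

Lemma L2null_zmod_closed : zmod_closed L2null.
Proof.
split; first by rewrite inE; exact/nearW.
move=> f g; rewrite !inE /=; apply: filterS2 => t ft gt.
by move: ft gt => /= ft gt; rewrite -[LHS]/(sval f t - sval g t) ft gt subr0.
Qed.

HB.instance Definition _ :=
  GRing.isZmodClosed.Build _ L2null L2null_zmod_closed.

Lemma L2nullZ (a : R[i]) f : f \in L2null -> a *: f \in L2null.
Proof. by move=> /L2nullP f0; apply/L2nullP; rewrite L2seminormZ f0 mulr0. Qed.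

Definition L2 : Type := Quotient.quot L2null.
HB.instance Definition _ := GRing.Zmodule.on L2.
HB.instance Definition _ :=
  ZmodQuotient.on L2.

Definition L2class (f : L2fun w) : L2 := \pi_L2%qT f.

Lemma L2classP f g : L2class f = L2class g <-> \forall t \ae wdt w, val f t = val g t.
Proof.
rewrite /L2class; split.
  move=> /eqP; rewrite -Quotient.idealrBE inE /=; apply: filterS => t fg.
  by apply/eqP; rewrite -subr_eq0; apply/eqP.
move=> fg; apply/eqP; rewrite -Quotient.idealrBE inE /=.
by apply: filterS fg => t fg; apply/eqP; rewrite subr_eq0; apply/eqP.
Qed.

Lemma L2class_repr (x : L2) : L2class (repr x) = x.
Proof. exact: reprK. Qed.

Lemma L2classD f g : L2class (f + g) = L2class f + L2class g.
Proof. by rewrite /L2class !piE. Qed.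

Lemma L2class_eq0 f : L2class f = 0 <-> f \in L2null.
Proof.
rewrite -[f in X in _ <-> X]subr0 Quotient.idealrBE.
rewrite (_ : 0 = L2class 0); first exact: (rwP eqP).
by rewrite /L2class piE.
Qed.

Lemma L2classB f g : L2class f = L2class g <-> f - g \in L2null.
Proof. by rewrite Quotient.idealrBE; exact: (rwP eqP). Qed.

Definition L2scale (a : R[i]) (x : L2) : L2 := L2class (a *: repr x).

Lemma L2classZ a f : L2class (a *: f) = L2scale a (L2class f).
Proof.
apply/L2classB; rewrite -scalerBr; apply: L2nullZ.
by apply/L2classB; rewrite L2class_repr.
Qed.

Let L2scalerA a b x : L2scale a (L2scale b x) = L2scale (a * b) x.
Proof. by rewrite -(L2class_repr x) -!L2classZ scalerA. Qed.

Let L2scale1r : left_id 1 L2scale.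
Proof. by move=> x; rewrite -(L2class_repr x) -!L2classZ scale1r. Qed.

Let L2scalerDr : right_distributive L2scale +%R.
Proof.
move=> a x y; rewrite -(L2class_repr x) -(L2class_repr y).
by rewrite -L2classD -!L2classZ -L2classD scalerDr.
Qed.

Let L2scalerDl x : {morph L2scale^~ x : a b / a + b}.
Proof.
by move=> a b; rewrite -(L2class_repr x) -!L2classZ -L2classD scalerDl.
Qed.

HB.instance Definition _ := GRing.Zmodule_isLmodule.Build R[i] L2
  L2scalerA L2scale1r L2scalerDr L2scalerDl.

Definition L2norm (x : L2) : R[i] := (L2seminorm (repr x))%:C.

Lemma L2norm_class f : L2norm (L2class f) = (L2seminorm f)%:C.
Proof.
have le g h : L2class g = L2class h -> L2seminorm g <= L2seminorm h.
  move=> /L2classB /L2nullP gh0.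
  by rewrite -(subrK h g) (le_trans (L2seminormD _ _))// gh0 add0r.
have e := L2class_repr (L2class f).
congr (_%:C); apply: le_anti; apply/andP; split; apply: le; [exact: e|exact: esym e].
Qed.

Let L2normD x y : L2norm (x + y) <= L2norm x + L2norm y.
Proof.
rewrite -(L2class_repr x) -(L2class_repr y) -L2classD !L2norm_class.
by rewrite -rmorphD lecR L2seminormD.
Qed.

Let L2normZ (a : R[i]) x : L2norm (a *: x) = `|a| * L2norm x.
Proof.
rewrite -(L2class_repr x) -[_ *: L2class _]L2classZ !L2norm_class.
by rewrite L2seminormZ rmorphM.
Qed.

Let L2norm0_eq0 x : L2norm x = 0 -> x = 0.
Proof.
rewrite -(L2class_repr x) L2norm_class => -[] x0.
by apply/L2class_eq0/L2nullP.
Qed.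

HB.instance Definition _ := Lmodule_isNormed.Build R[i] L2
  L2normD L2normZ L2norm0_eq0.

Lemma L2_normE (x : L2) : `|x| = L2norm x.
Proof. reflexivity. Qed.

End L2_space.

Section bases.
Context (K : numFieldType) (X : normedModType K).
Implicit Types (b : nat -> X) (bs : nat -> {linear X -> K^o}) (x : X).

Definition schauder_basis b := forall x, exists! a : nat -> K,
  \sum_(k < n) a k *: b k @[n --> \oo] --> x.

Definition bounded_schauder_basis b := schauder_basis b /\
  exists m M : K, 0 < m /\ forall k, m <= `|b k| <= M.

Definition dual_system b bs :=
  (forall k, continuous (bs k)) /\ forall j k, bs j (b k) = (j == k)%:R.

Definition greedy_ordering bs x (rho : nat -> nat) :=
  (forall j, bs j x != 0 -> exists k, rho k = j) /\
  forall j k, (j < k)%N ->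
    `|bs (rho k) x| < `|bs (rho j) x| \/
    (`|bs (rho k) x| = `|bs (rho j) x| /\ (rho j < rho k)%N).

Definition greedy_approximant b bs x (rho : nat -> nat) (m : nat) : X :=
  \sum_(j < m) bs (rho j) x *: b (rho j).

(* Existence (and uniqueness) of the dual system is automatic in a Banach
   space. The greedy ordering also always exists; when x has finitely many
   nonzero coefficients its values past them are not determined, but the greedy
   approximants are. *)
Definition quasi_greedy_basis b :=
  bounded_schauder_basis b /\
  exists bs, dual_system b bs /\
    forall x, exists rho, greedy_ordering bs x rho /\
      greedy_approximant b bs x rho m @[m --> \oo] --> x.

Definition linear_span b : set X :=
  [set y | exists n (a : nat -> K), y = \sum_(k < n) a k *: b k].

(* A finite scalar sequence is given by its terms of index less than n, for some
   n; terms in between may be 0. *)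
Definition riesz_basis b :=
  dense (linear_span b) /\
  exists A B : K, [/\ 0 < A, A <= B & forall n (a : nat -> K),
    A * \sum_(k < n) `|a k| ^+ 2 <= `|\sum_(k < n) a k *: b k| ^+ 2
      <= B * \sum_(k < n) `|a k| ^+ 2].

End bases.

Section trigonometric_system.
Context (R : realType).

Definition trig (k : int) (t : R) : R[i]^o :=
  ((Num.sqrt (2 * pi))^-1)%:C * (cos (k%:~R * t) +i* sin (k%:~R * t)).

(* 0, -1, 1, -2, 2, ... with indices starting from 0 *)
Definition trig_index (k : nat) : int := (-1) ^+ k * (uphalf k)%:Z.

Definition trig_system (w : weight R)
    (h : forall k, trig (trig_index k) \in inL2 w) : nat -> L2 w :=
  fun k => L2class (exist _ (trig (trig_index k)) (h k)).

End trigonometric_system.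

(* Main.v *)
(* A gliding hump argument shows that quasi-greediness forces
   |sum_(k in B) c_k u_k| <= kappa |sum_(k < n) c_k u_k| for unimodular c, any B
   and u_k = e^(ikt), k >= 0: multiplication by e^(iLt) is an isometry of L^2(w), so bad
   blocks can be moved to disjoint sets of frequencies, and in a suitable sum
   of rescaled blocks the greedy approximants are not Cauchy. Hence signs can
   be changed at bounded cost, and choosing them by the parallelogram law yields
   |sum_(k < n) c_k u_k|^2 ~ n for all unimodular c, i.e. the Fejer means of w
   lie between two positive constants. Averaging
   |P(z)|^2 |sum_(i < n) z^(-i) u_i|^2 over the roots of unity z then transfers the bounds to
   |P|^2 w for every trigonometric polynomial P: by Parseval the average is
   a sum over m of the squared norms of the parts of P in windows of length n,
   most of which contain all of P. *)

Require Import Defs.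
From HB Require Import structures.
From mathcomp Require Import all_boot all_order all_algebra.
From mathcomp Require Import cyclic separable cyclotomic.
From mathcomp Require Import zify ring lra complex ring_quotient.
From mathcomp Require Import all_classical all_reals all_analysis measurable_realfun.

Set Implicit Arguments.
Unset Strict Implicit.
Unset Printing Implicit Defensive.

Import Order.TTheory GRing.Theory Num.Theory.
Import numFieldNormedType.Exports.

Local Open Scope classical_set_scope.
Local Open Scope ring_scope.

(** * Greedy approximants given by dominating index sets *)

Section greedy_sets.
Context (K : numFieldType) (X : normedModType K).
Variables (b : nat -> X) (bs : nat -> {linear X -> K^o}).

(** An index outside [A] cannot be among the first [size A] values of [rho]: every element of [A]
    has a nonzero, strictly larger coefficient, hence is listed earlier, and there is no room for
    all of them. *)
Lemma greedy_approximant_set x rho (A : seq nat) :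
  greedy_ordering bs x rho -> uniq A ->
  (forall k, k \in A -> bs k x != 0) ->
  (forall k l, k \in A -> l \notin A -> `|bs l x| < `|bs k x|) ->
  greedy_approximant b bs x rho (size A) = \sum_(k <- A) bs k x *: b k.
Proof.
move=> [surj ord] uA A0 Alt.
have inj : injective rho.
  move=> j k; wlog: j k / (j <= k)%N.
    by move=> H; case/orP: (leq_total j k) => h /esym e; [exact/H|exact/esym/H].
  rewrite leq_eqVlt => /orP[/eqP//|jk] e; case: (ord _ _ jk); rewrite e ?ltxx// => -[_].
  by rewrite ltnn.
pose s := [seq rho i | i <- iota 0 (size A)].
have us : uniq s by rewrite map_inj_uniq ?iota_uniq.
have sA : {subset s <= A}.
  move=> z /mapP[ i]; rewrite mem_iota add0n => /= iA ->.
  apply: contraT => riA.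
  have : {subset A <= [seq rho j | j <- iota 0 i]}.
    move=> k kA; have [j jk] := surj _ (A0 _ kA); rewrite -jk map_f// mem_iota/= add0n.
    rewrite ltnNge; apply/negP => ij; move: (Alt _ _ kA riA); rewrite -jk => lt1.
    move: ij; rewrite leq_eqVlt => /orP[/eqP ij|ij]; first by rewrite ij ltxx in lt1.
    case: (ord _ _ ij) => [lt2|[e _]]; last by rewrite e ltxx in lt1.
    by have := lt_trans lt1 lt2; rewrite ltxx.
  move=> /(uniq_leq_size uA); rewrite size_map size_iota => h.
  by have := leq_ltn_trans h iA; rewrite ltnn.
have pAs : perm_eq A s.
  rewrite perm_sym; apply: uniq_perm => //.
  by have [] := uniq_min_size us sA (_ : size A <= size s)%N; rewrite ?size_map ?size_iota.
by rewrite (perm_big _ pAs)/= /greedy_approximant big_map -(big_mkord xpredT (fun j => bs (rho j) x *: b (rho j))) /index_iota subn0.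
Qed.

End greedy_sets.

(** * The gliding hump: suppression bounds from greedy convergence *)

Section gliding_hump.
Context (K : numFieldType) (X : normedModType K).
Variables (b : nat -> X) (bs : nat -> {linear X -> K^o}).
Hypothesis dual : dual_system b bs.
Hypothesis greedy_cvg : forall x, exists rho, greedy_ordering bs x rho /\
  greedy_approximant b bs x rho m @[m --> \oo] --> x.
(** Completeness, in the form needed to sum the blocks. *)
Hypothesis summable : forall y : nat -> X, (forall n, `|y n| <= 2^-1 ^+ n) ->
  exists x : X, \sum_(i < n) y i @[n --> \oo] --> x.
(** Selects a subsystem on which index translation is isometric. In the application [f k] is 2k, the
    position of the frequency k >= 0. *)
Variable f : nat -> nat.
Hypothesis f_inj : injective f.
Let u k := b (f k).
Hypothesis shift : forall n (a : nat -> K) L,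
  `|\sum_(k < n) a k *: u (k + L)| = `|\sum_(k < n) a k *: u k|.

(* One block of the gliding hump: all its coefficients lie in [d, D[, those
   with index in B strictly dominate the others, and yet the block has norm at
   most eps while its part indexed by B, a greedy approximant, has norm at
   least 1. *)
Definition hump (t : seq K) (B : pred nat) (eps D d : K) :=
  [/\ 0 < d, forall k, (k < size t)%N -> d <= `|t`_k| < D,
    forall k l, (k < size t)%N -> (l < size t)%N -> B k -> ~~ B l -> `|t`_l| < `|t`_k|,
    `|\sum_(k < size t) t`_k *: u k| <= eps &
    1 <= `|\sum_(k < size t | B k) t`_k *: u k|].

Definition suppression_bounded := exists kappa : K, 0 < kappa /\
  forall n (B : pred nat) (c : nat -> K), (forall k, `|c k| = 1) ->
    `|\sum_(k < n | B k) c k *: u k| <= kappa * `|\sum_(k < n) c k *: u k|.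

(** The functional dual to [u 0] is continuous and takes the value [c 0], of modulus 1, on the sum;
    so the sum stays out of a ball around 0 on which the functional is smaller than 1. *)
Lemma coef_lower_bound : exists2 mu : K, 0 < mu &
  forall n (c : nat -> K), (0 < n)%N -> `|c 0%N| = 1 -> mu <= `|\sum_(k < n) c k *: u k|.
Proof.
have /(_ 0) := dual.1 (f 0%N).
move=> /cvgrPdist_lt/(_ 1 ltr01); rewrite linear0 => /nbhs_normP[e /= e0 He].
exists e => // n c n0 c0; rewrite real_leNgt ?normr_real ?gtr0_real//.
apply/negP => lt_e; have := He (\sum_(k < n) c k *: u k).
rewrite /ball_/= !sub0r !normrN => /(_ lt_e).
rewrite linear_sum; case: n n0 {lt_e} => // n _.
rewrite big_ord_recl/= linearZ/= dual.2 eqxx big1 ?addr0; last first.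
  by move=> i _; rewrite linearZ/= dual.2 (inj_eq f_inj) scaler0.
by rewrite /GRing.scale/= mulr1 c0 ltxx.
Qed.

(** A unimodular sum violating suppression is divided by the norm [beta] of its part in [B]. Then
    the coefficients in [B] are enlarged by the factor 1 + [eta], which makes the domination strict
    and adds at most [eta] = eps / 2 to the norm. *)
Lemma hump_exists : ~ suppression_bounded ->
  forall eps D : K, 0 < eps -> eps <= 1 -> 0 < D -> exists t B d, hump t B eps D d.
Proof.
move=> nsb eps D eps0 eps1 D0; have [mu mu0 Hmu] := coef_lower_bound.
(* The first summand makes the rescaled block small, the second one its coefficients. *)
pose kappa := 2 / eps + 2 / (D * mu).
have k1 : 0 < 2 / eps by rewrite divr_gt0.
have k2 : 0 < 2 / (D * mu) by rewrite divr_gt0// mulr_gt0.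
have kap0 : 0 < kappa by rewrite addr_gt0.
have [n [B [c [c1 lt_kap]]]] : exists n (B : pred nat) (c : nat -> K),
    (forall k, `|c k| = 1) /\
    kappa * `|\sum_(k < n) c k *: u k| < `|\sum_(k < n | B k) c k *: u k|.
  apply: contrapT => H; apply: nsb; exists kappa; split=> // n B c c1.
  rewrite real_leNgt ?realM ?normr_real ?gtr0_real//.
  by apply/negP => ?; apply: H; exists n, B, c.
set S := \sum_(k < n) _ in lt_kap; set SB := \sum_(k < n | _) _ in lt_kap.
have n0 : (0 < n)%N.
  by case: n @S @SB lt_kap => // S SB; rewrite /S /SB !big_ord0 normr0 mulr0 ltxx.
have muS : mu <= `|S| by exact: Hmu.
pose beta := `|SB|.
have beta0 : 0 < beta.
  by apply: le_lt_trans lt_kap; rewrite mulr_ge0// ltW.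
have delta0 : 0 < beta^-1 by rewrite invr_gt0.
have [eta eta0 etaE] : exists2 eta, 0 < eta & eta = eps / 2.
  by exists (eps / 2); rewrite // divr_gt0.
have eta1 : 1 + eta <= 2.
  by rewrite (_ : 2 = 1 + 1 :> K)// lerD2l etaE ler_pdivrMr// mul1r (le_trans eps1)// ler1n.
pose a k := beta^-1 * (c k * (1 + eta *+ B k)).
have an k : `|a k| = beta^-1 * (1 + eta *+ B k).
  rewrite /a !normrM c1 mul1r (gtr0_norm delta0); congr (_ * _).
  by rewrite ger0_norm// addr_ge0// mulrn_wge0// ltW.
have tk k : (k < n)%N -> (mkseq a n)`_k = a k by move=> kn; rewrite nth_mkseq.
exists (mkseq a n), B, beta^-1; split => //.
- move=> k; rewrite size_mkseq => /tk ->; rewrite an; apply/andP; split.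
    by rewrite -[leLHS]mulr1 ler_pM2l// lerDl mulrn_wge0// ltW.
  apply: (@le_lt_trans _ _ (beta^-1 * 2)).
    rewrite ler_pM2l// (le_trans _ eta1)// lerD2l.
    by case: (B k); rewrite ?mulr1n// mulr0n ltW.
  rewrite mulrC ltr_pdivrMr// mulrC -ltr_pdivrMr//.
  apply: le_lt_trans lt_kap; apply: (@le_trans _ _ (kappa * mu)); last by rewrite ler_pM2l.
  rewrite /kappa [leRHS]mulrDl; apply: ler_wpDl; first by rewrite mulr_ge0 ?ltW.
  by rewrite invfM mulrA mulfVK// gt_eqF.
- move=> k l; rewrite !size_mkseq => /tk -> /tk -> Bk Bl.
  by rewrite !an Bk (negbTE Bl) mulr0n addr0 mulr1n ltr_pM2l// ltrDl.
- rewrite size_mkseq (eq_bigr (fun k : 'I_n => beta^-1 *: (c k *: u k) +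
      (beta^-1 * eta) *: ((c k *: u k) *+ B k))); last first.
    move=> k _; rewrite tk// /a; case: (B k).
      by rewrite !mulr1n !scalerA -scalerDl; congr (_ *: _); ring.
    by rewrite !mulr0n addr0 mulr1 scaler0 addr0 scalerA.
  rewrite big_split/= -!scaler_sumr -/S.
  have -> : \sum_(i < n) c i *: u i *+ B i = SB.
    rewrite /SB [RHS]big_mkcond; apply: eq_bigr => i _.
    by case: (B i); rewrite ?mulr1n.
  apply: le_trans (ler_normD _ _) _; rewrite !normrZ ?normrM (gtr0_norm delta0) (gtr0_norm eta0).
  rewrite mulrAC -/beta mulVf ?gt_eqF// mul1r.
  rewrite [leRHS](_ : _ = eps / 2 + eta); last by rewrite etaE -splitr.
  rewrite lerD2r mulrC ler_pdivrMr//.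
  have -> : eps / 2 = (2 / eps)^-1 by rewrite invf_div.
  rewrite mulrC ler_pdivlMr// mulrC; apply: le_trans (ltW lt_kap).
  by rewrite ler_wpM2r// /kappa lerDl ltW.
- rewrite size_mkseq (eq_bigr (fun k : 'I_n => (beta^-1 * (1 + eta)) *: (c k *: u k))); last first.
    by move=> k Bk; rewrite tk// /a Bk mulr1n scalerA; congr (_ *: _); ring.
  rewrite -scaler_sumr normrZ -/SB normrM (gtr0_norm delta0) -/beta mulrAC mulVf ?gt_eqF//.
  by rewrite mul1r ger0_norm ?addr_ge0 ?ltW// ltrDl.
Qed.


(** * Concatenation of the humps into one vector *)

Section blocks.
(** A choice of humps: coefficients, dominating set, and a lower bound for the coefficients, which
    becomes the upper level for the next block. *)
Variable blk : nat -> K -> seq K * pred nat * K.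
Hypothesis blkP : forall n D, 0 < D ->
  hump (blk n D).1.1 (blk n D).1.2 (2^-1 ^+ n) D (blk n D).2.

(* [prefix n] is the coefficient sequence of the first n blocks together with the
   strict upper bound for the coefficients of all later blocks. *)
Fixpoint prefix n : seq K * K :=
  if n is n'.+1 then
    let: (s, D) := prefix n' in (s ++ (blk n' D).1.1, (blk n' D).2)
  else ([::], 1).

Let s n := (prefix n).1.
Let D n := (prefix n).2.
Let t n := (blk n (D n)).1.1.
Let B n := (blk n (D n)).1.2.

Lemma prefixS n : s n.+1 = s n ++ t n.
Proof. by rewrite /s /t /D /=; case: (prefix n). Qed.

Lemma levelS n : D n.+1 = (blk n (D n)).2.
Proof. by rewrite /D /=; case: (prefix n). Qed.

Lemma level_gt0 n : 0 < D n.
Proof. by elim: n => [|n IH]; [exact: ltr01|rewrite levelS; case: (blkP n IH)]. Qed.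

Lemma blockP n : hump (t n) (B n) (2^-1 ^+ n) (D n) (D n.+1).
Proof. by rewrite levelS; exact/blkP/level_gt0. Qed.

Lemma block_size n : (0 < size (t n))%N.
Proof.
case: (blockP n) => _ _ _ _; case: (t n) => //=.
by rewrite big_ord0 normr0 ler10.
Qed.

Lemma levelS_lt n : D n.+1 < D n.
Proof.
case: (blockP n) => _ /(_ _ (block_size n)) /andP[h1 h2] _ _ _.
exact: le_lt_trans h2.
Qed.

Lemma level_le m n : (m <= n)%N -> D n <= D m.
Proof.
elim: n => [|n IH]; first by rewrite leqn0 => /eqP ->.
rewrite leq_eqVlt => /orP[/eqP -> //|]; rewrite ltnS => /IH.
exact/le_trans/ltW/levelS_lt.
Qed.

Lemma prefix_sizeS n : size (s n.+1) = (size (s n) + size (t n))%N.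
Proof. by rewrite prefixS size_cat. Qed.

Lemma prefix_size n : (n <= size (s n))%N.
Proof.
elim: n => // n IH; rewrite prefix_sizeS -addn1.
by rewrite leq_add// block_size.
Qed.

Lemma prefix_size_le m n : (m <= n)%N -> (size (s m) <= size (s n))%N.
Proof.
elim: n => [|n IH]; first by rewrite leqn0 => /eqP ->.
rewrite leq_eqVlt => /orP[/eqP -> //|]; rewrite ltnS => /IH h.
by rewrite prefix_sizeS (leq_trans h)// leq_addr.
Qed.

(** Coefficients of the infinite concatenation; blocks are nonempty, so [s j.+1] already has an
    entry of index j. *)
Let alpha j := (s j.+1)`_j.

Lemma prefix_nth m n j : (m <= n)%N -> (j < size (s m))%N -> (s n)`_j = (s m)`_j.
Proof.
elim: n => [|n IH]; first by rewrite leqn0 => /eqP ->.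
rewrite leq_eqVlt => /orP[/eqP -> //|]; rewrite ltnS => mn jm.
by rewrite prefixS nth_cat (leq_trans jm) ?prefix_size_le// IH.
Qed.

Lemma coefE n j : (j < size (s n))%N -> alpha j = (s n)`_j.
Proof.
move=> jn; have [h|/ltnW h] := leqP n j.+1; first by rewrite /alpha (prefix_nth h).
by rewrite /alpha (prefix_nth h)// prefix_size.
Qed.

Lemma coef_block n k : (k < size (t n))%N -> alpha (size (s n) + k) = (t n)`_k.
Proof.
move=> kt; rewrite (coefE (n := n.+1)) ?prefix_sizeS ?ltn_add2l//.
by rewrite prefixS nth_cat ltnNge leq_addr/= addKn.
Qed.

(** With [coef_lt]: the level [D n] separates the first n blocks from all later ones, so each prefix
    is a greedy set. *)
Lemma coef_ge n j : (j < size (s n))%N -> D n <= `|alpha j|.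
Proof.
elim: n => // n IH; rewrite prefix_sizeS.
have [h _|h] := ltnP j (size (s n)); first by rewrite (le_trans _ (IH h))// ltW// levelS_lt.
rewrite -{1}(subnKC h) ltn_add2l => jt; rewrite -(subnKC h) coef_block//.
by case: (blockP n) => _ /(_ _ jt) /andP[].
Qed.

Lemma coef_lt n j : (size (s n) <= j)%N -> `|alpha j| < D n.
Proof.
move=> nj; have [m] : exists m, (j < size (s (n + m)))%N.
  by exists j.+1; apply: leq_trans (prefix_size _); rewrite leq_addl.
elim: m => [|m IH]; first by rewrite addn0 ltnNge nj.
rewrite addnS prefix_sizeS; have [h _|h] := ltnP j (size (s (n + m))); first exact: IH.
rewrite -{1}(subnKC h) ltn_add2l => jt; rewrite -(subnKC h) coef_block//.
case: (blockP (n + m)) => _ /(_ _ jt) /andP[_ h2] _ _ _.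
by rewrite (lt_le_trans h2)// level_le// leq_addr.
Qed.

(** The n-th block moved past the preceding ones; by [shift] its norm is still at most 2^-n. *)
Let y n := \sum_(k < size (t n)) (t n)`_k *: u (k + size (s n)).

Lemma partial_sum n : \sum_(i < n) y i = \sum_(j < size (s n)) alpha j *: u j.
Proof.
elim: n => [|n IH]; first by rewrite !big_ord0.
rewrite big_ord_recr /= IH prefix_sizeS big_split_ord /=; congr (_ + _).
by apply: eq_bigr => k _; rewrite coef_block// addnC.
Qed.

(** For the sum x of all blocks, both the first N blocks and these together with the part in [B N]
    of the next one are greedy approximants. They differ by a vector of norm at least 1, for every
    N. *)
Lemma humps_contradiction : False.
Proof.
have [x Sx] : exists x : X, \sum_(i < n) y i @[n --> \oo] --> x.
  by apply: summable => n; rewrite /y shift; case: (blockP n).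
(* A coefficient that is eventually constant along the partial sums passes to the limit, by
   continuity of [bs k]. *)
have coefx k (z : K) N : (forall n, (N <= n)%N -> bs k (\sum_(i < n) y i) = z) -> bs k x = z.
  move=> H; have c1 : (bs k (\sum_(i < n) y i) : K^o) @[n --> \oo] --> bs k x.
    exact: continuous_cvg (dual.1 k x) Sx.
  have c2 : (bs k (\sum_(i < n) y i) : K^o) @[n --> \oo] --> (z : K^o).
    by apply: cvg_near_cst; exists N => // n /= /H ->.
  exact: (cvg_unique _ c1 c2).
have coef_f j : bs (f j) x = alpha j.
  apply: (@coefx _ _ j.+1) => n jn; rewrite partial_sum linear_sum.
  have js : (j < size (s n))%N by exact: leq_trans (prefix_size n).
  rewrite (bigD1 (Ordinal js))//= linearZ/= dual.2 eqxx big1 ?addr0.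
    by rewrite /GRing.scale/= mulr1.
  move=> i ij; rewrite linearZ/= dual.2 (inj_eq f_inj).
  by move: ij; rewrite -(inj_eq val_inj) eq_sym /= => /negbTE ->; rewrite scaler0.
have coef_other k : (forall j, k != f j) -> bs k x = 0.
  move=> kf; apply: (@coefx _ _ 0%N) => n _; rewrite partial_sum linear_sum big1// => i _.
  by rewrite linearZ/= dual.2 (negbTE (kf _)) scaler0.
have [rho [ord Gx]] := greedy_cvg x.
(* Domination among the [alpha] suffices, because x has zero coefficients outside the range of
   [f]. *)
have greedy_set (J : seq nat) : uniq J ->
    (forall j, j \in J -> 0 < `|alpha j|) ->
    (forall j l, j \in J -> l \notin J -> `|alpha l| < `|alpha j|) ->
    greedy_approximant b bs x rho (size J) = \sum_(j <- J) alpha j *: u j.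
  move=> uJ J0 Jlt; rewrite -(size_map f J) (greedy_approximant_set b ord).
  - by rewrite big_map; apply: eq_bigr => j _; rewrite coef_f.
  - by rewrite map_inj_uniq.
  - by move=> k /mapP[j jJ ->]; rewrite coef_f -normr_gt0 J0.
  move=> k l /mapP[j jJ ->]; rewrite coef_f => lJ.
  have [[l' ll']|nl] := pselect (exists l', l = f l').
    rewrite ll' coef_f; apply: Jlt => //; apply: contra lJ => ?.
    by rewrite ll' map_f.
  rewrite coef_other ?normr0 ?J0// => l'.
  by apply/eqP => ll'; apply: nl; exists l'.
(* Two approximants within 1/2 of x are at distance less than 1. *)
move/cvgrPdist_lt : Gx => /(_ 2^-1); rewrite invr_gt0 ltr0n => /(_ isT) [N _ GN].
pose J := iota 0 (size (s N)).
pose J' := J ++ [seq (size (s N) + k)%N | k <- iota 0 (size (t N)) & B N k].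
have JP j : (j \in J) = (j < size (s N))%N by rewrite mem_iota add0n.
have J'P j : (j \in J') = (j < size (s N))%N ||
    [&& (size (s N) <= j)%N, (j < size (s N.+1))%N & B N (j - size (s N))%N].
  rewrite mem_cat JP; congr (_ || _); apply/mapP/idP.
    move=> [k]; rewrite mem_filter mem_iota add0n => /andP[Bk kt] ->.
    by rewrite leq_addr prefix_sizeS ltn_add2l addKn Bk andbT.
  move=> /and3P[h1 h2 h3]; exists (j - size (s N))%N; last by rewrite subnKC.
  by rewrite mem_filter h3 mem_iota add0n -(ltn_add2l (size (s N))) subnKC// -prefix_sizeS.
have uJ : uniq J by exact: iota_uniq.
have uJ' : uniq J'.
  rewrite cat_uniq uJ map_inj_uniq ?filter_uniq ?iota_uniq ?andbT//; last exact: addnI.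
  by apply/hasPn => _ /mapP[k _ ->]; rewrite JP -leqNgt leq_addr.
have J'lt j : j \in J' -> (j < size (s N.+1))%N.
  by rewrite J'P prefix_sizeS => /orP[h|/and3P[]//]; rewrite ltn_addr.
have GJ : greedy_approximant b bs x rho (size J) = \sum_(j <- J) alpha j *: u j.
  apply: greedy_set => // j; rewrite JP => jN.
    exact: lt_le_trans (level_gt0 N) (coef_ge jN).
  by move=> l; rewrite JP -leqNgt => /coef_lt/lt_le_trans; apply; exact: coef_ge.
have GJ' : greedy_approximant b bs x rho (size J') = \sum_(j <- J') alpha j *: u j.
  apply: greedy_set => // j; first by move=> /J'lt/coef_ge; apply: lt_le_trans (level_gt0 _).
  move=> l jJ'; have jlt := J'lt _ jJ'.
  have [l2 _|l2] := leqP (size (s N.+1)) l.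
    exact: lt_le_trans (coef_lt l2) (coef_ge jlt).
  rewrite J'P negb_or -leqNgt l2/= => /andP[l1]; rewrite l1/= => nBl.
  move: jJ'; rewrite J'P => /orP[j1|/and3P[j1 j2 Bj]].
    exact: lt_le_trans (coef_lt l1) (coef_ge j1).
  have shifted i : (size (s N) <= i)%N -> (i < size (s N.+1))%N ->
      (i - size (s N) < size (t N))%N /\ alpha i = (t N)`_(i - size (s N)).
    move=> i1 i2; have it : (i - size (s N) < size (t N))%N.
      by rewrite -(ltn_add2l (size (s N))) subnKC// -prefix_sizeS.
    by split=> //; rewrite -(coef_block it) subnKC.
  have [lt ->] := shifted _ l1 l2; have [jt ->] := shifted _ j1 j2.
  by case: (blockP N) => _ _ + _ _; apply.
have sJ : (N <= size J)%N by rewrite size_iota prefix_size.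
have sJ' : (N <= size J')%N by rewrite size_cat (leq_trans sJ)// leq_addr.
(* Up to a shift the difference is the part of block N in [B N]. *)
have : 1 <= `|(x - greedy_approximant b bs x rho (size J)) -
             (x - greedy_approximant b bs x rho (size J'))|.
  rewrite opprB addrC addrA subrK GJ GJ' /J' big_cat /= addrC addKr.
  rewrite big_map big_filter (_ : iota 0 _ = index_iota 0 (size (t N))); last by rewrite /index_iota subn0.
  rewrite big_mkord.
  rewrite big_mkcond /=.
  case: (blockP N) => _ _ _ _; rewrite big_mkcond /=.
  have := shift (size (t N)) (fun k => if B N k then (t N)`_k else 0) (size (s N)).
  move=> h1 h2; apply: le_trans h2 _; rewrite le_eqVlt; apply/orP; left; apply/eqP.
  transitivity `|\sum_(k < size (t N)) (if B N k then (t N)`_k else 0) *: u k|.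
    by congr (`|_|); apply: eq_bigr => k _; case: ifP; rewrite ?scale0r.
  rewrite -h1; congr (`|_|); apply: eq_bigr => k _; case: ifP; rewrite ?scale0r//.
  by rewrite coef_block// addnC.
apply/negP; rewrite -real_ltNge ?normr_real//.
apply: le_lt_trans (ler_normB _ _) _.
by rewrite [ltRHS]splitr mul1r ltrD// GN.
Qed.

End blocks.

Lemma quasi_greedy_suppression : suppression_bounded.
Proof.
apply: contrapT => nsb.
pose P (p : nat * K) (r : seq K * pred nat * K) :=
  0 < p.2 -> hump r.1.1 r.1.2 (2^-1 ^+ p.1) p.2 r.2.
have /choice[g gP] : forall p, exists r, P p r.
  move=> [n D]; rewrite /P/=.
  (* If D is not positive, [P] is vacuous and any triple serves. *)
  have [D0|nD] := pselect (0 < D); last by exists ([::], xpred0 : pred nat, 0).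
  have e0 : 0 < 2^-1 ^+ n :> K by rewrite exprn_gt0// invr_gt0.
  have e1 : 2^-1 ^+ n <= 1 :> K by rewrite exprn_ile1 ?invr_ge0// invf_le1// ler1n.
  by have [t [B [d tB]]] := hump_exists nsb e0 e1 D0; exists (t, B, d).
exact: (@humps_contradiction (fun n D => g (n, D)) (fun n D => gP (n, D))).
Qed.

End gliding_hump.

(** Takes the place of an inner product: scalar identities of this shape carry over to vectors. The
    instances are the parallelogram law and Parseval over roots of unity. *)
Definition quadratic_transfer (K : numFieldType) (X : normedModType K) :=
  forall (S T : nat) (c : 'I_S -> 'I_T -> K) (lam : nat),
  (forall z : 'I_T -> K,
    \sum_s `|\sum_t c s t * z t| ^+ 2 = lam%:R * \sum_t `|z t| ^+ 2) ->
  forall v : 'I_T -> X,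
    \sum_s `|\sum_t c s t *: v t| ^+ 2 = lam%:R * \sum_t `|v t| ^+ 2.


(** * Choice of signs and the size of unimodular sums *)

Section signs.
Context (K : numClosedFieldType) (X : normedModType K).
Hypothesis transfer : quadratic_transfer X.
Implicit Types (x y : X) (v : nat -> X).

Lemma parallelogram x y :
  `|x + y| ^+ 2 + `|x - y| ^+ 2 = 2 * (`|x| ^+ 2 + `|y| ^+ 2).
Proof.
(* The matrix with rows (1, 1) and (1, -1). *)
pose c (s t : 'I_2) : K := if (s == ord_max) && (t == ord_max) then -1 else 1.
have H (z : 'I_2 -> K) :
    \sum_s `|\sum_t c s t * z t| ^+ 2 = 2 * \sum_t `|z t| ^+ 2.
  rewrite !(big_ord_recr, big_ord0)/= !add0r /c /= !mul1r mulN1r.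
  rewrite !normCK !(rmorphD, rmorphN)/=; ring.
have := transfer H (fun t => if t == ord_max then y else x).
rewrite !(big_ord_recr, big_ord0)/= !add0r /c /= !scale1r scaleN1r.
by [].
Qed.

(** By the parallelogram law |x|^2 + |y|^2 is the mean of |x + y|^2 and |x - y|^2; one of them is
    not above the mean, and for [sign_ge] one is not below it. *)
Lemma sign_le x y : exists e : bool,
  `|x + (-1) ^+ e *: y| ^+ 2 <= `|x| ^+ 2 + `|y| ^+ 2.
Proof.
apply: contrapT => H.
have h (e : bool) : `|x| ^+ 2 + `|y| ^+ 2 < `|x + (-1) ^+ e *: y| ^+ 2.
  rewrite real_ltNge ?rpredD ?rpredX ?normr_real//.
  by apply/negP => he; apply: H; exists e.
have := ltrD (h false) (h true); rewrite expr0 expr1 scale1r scaleN1r parallelogram.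
by rewrite mulr_natl mulr2n ltxx.
Qed.

Lemma sign_ge x y : exists e : bool,
  `|x| ^+ 2 + `|y| ^+ 2 <= `|x + (-1) ^+ e *: y| ^+ 2.
Proof.
apply: contrapT => H.
have h (e : bool) : `|x + (-1) ^+ e *: y| ^+ 2 < `|x| ^+ 2 + `|y| ^+ 2.
  rewrite real_ltNge ?rpredD ?rpredX ?normr_real//.
  by apply/negP => he; apply: H; exists e.
have := ltrD (h false) (h true); rewrite expr0 expr1 scale1r scaleN1r parallelogram.
by rewrite mulr_natl mulr2n ltxx.
Qed.

Lemma sum_sign_extend n v (e : nat -> bool) (d : bool) :
  \sum_(k < n.+1) (-1) ^+ (if k == n :> nat then d else e k) *: v k =
  \sum_(k < n) (-1) ^+ e k *: v k + (-1) ^+ d *: v n.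
Proof.
rewrite big_ord_recr /= eqxx; congr (_ + _); apply: eq_bigr => k _.
by rewrite ltn_eqF.
Qed.

Lemma signs_le n v : exists e : nat -> bool,
  `|\sum_(k < n) (-1) ^+ e k *: v k| ^+ 2 <= \sum_(k < n) `|v k| ^+ 2.
Proof.
elim: n => [|n [e IH]]; first by exists xpredT; rewrite !big_ord0 normr0 expr0n.
have [d Hd] := sign_le (\sum_(k < n) (-1) ^+ e k *: v k) (v n).
exists (fun k => if k == n then d else e k); rewrite sum_sign_extend.
by apply: le_trans Hd _; rewrite big_ord_recr lerD2r.
Qed.

Lemma signs_ge n v : exists e : nat -> bool,
  \sum_(k < n) `|v k| ^+ 2 <= `|\sum_(k < n) (-1) ^+ e k *: v k| ^+ 2.
Proof.
elim: n => [|n [e IH]]; first by exists xpredT; rewrite !big_ord0 normr0 expr0n.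
have [d Hd] := sign_ge (\sum_(k < n) (-1) ^+ e k *: v k) (v n).
exists (fun k => if k == n then d else e k); rewrite sum_sign_extend.
by apply: le_trans Hd; rewrite big_ord_recr lerD2r.
Qed.

Variables (u : nat -> X) (kappa nu : K).
Hypothesis kappa0 : 0 < kappa.
Hypothesis nu0 : 0 < nu.
Hypothesis u_norm : forall k, `|u k| = nu.
Hypothesis suppress : forall n (B : pred nat) (c : nat -> K), (forall k, `|c k| = 1) ->
  `|\sum_(k < n | B k) c k *: u k| <= kappa * `|\sum_(k < n) c k *: u k|.

(* Split the signs: up to sign, both halves of the left-hand side are partial sums of
   the signed sum on the right. *)
Lemma sign_change n (z : nat -> K) (e : nat -> bool) : (forall k, `|z k| = 1) ->
  `|\sum_(k < n) z k *: u k| <=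
    2 * kappa * `|\sum_(k < n) (-1) ^+ e k *: (z k *: u k)|.
Proof.
move=> z1; pose c k := (-1) ^+ e k * z k.
have c1 k : `|c k| = 1 by rewrite normrM normrX normrN1 expr1n mul1r.
have -> : \sum_(k < n) (-1) ^+ e k *: (z k *: u k) = \sum_(k < n) c k *: u k.
  by apply: eq_bigr => k _; rewrite scalerA.
rewrite (bigID (fun k : 'I_n => e k))/=.
have -> : \sum_(k < n | e k) z k *: u k = - \sum_(k < n | e k) c k *: u k.
  rewrite -sumrN; apply: eq_bigr => k ek.
  by rewrite /c ek expr1 mulN1r scaleNr opprK.
have -> : \sum_(k < n | ~~ e k) z k *: u k = \sum_(k < n | ~~ e k) c k *: u k.
  by apply: eq_bigr => k /negbTE ek; rewrite /c ek expr0 mul1r.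
apply: le_trans (ler_normD _ _) _; rewrite normrN -mulrA mulr_natl mulr2n.
by apply: lerD; [exact: (suppress n e c1)|exact: (suppress n (fun k => ~~ e k) c1)].
Qed.

(** Suitable signs make the squared norm at least, or at most, nu^2 n, and [sign_change] compares
    the signed sum with the given one at the cost of a factor 2 kappa. *)
Lemma unimodular_sum_bounds n (z : nat -> K) : (forall k, `|z k| = 1) ->
  (nu / (2 * kappa)) ^+ 2 * n%:R <= `|\sum_(k < n) z k *: u k| ^+ 2
    <= (2 * kappa * nu) ^+ 2 * n%:R.
Proof.
move=> z1; have k0 : 0 < 2 * kappa by rewrite mulr_gt0.
have kw := ltW kappa0; have nuw := ltW nu0.
have vn : \sum_(k < n) `|z k *: u k| ^+ 2 = nu ^+ 2 * n%:R.
  under eq_bigr do rewrite normrZ z1 mul1r u_norm.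
  by rewrite sumr_const card_ord mulr_natr.
apply/andP; split.
  have [e] := signs_ge n (fun k => z k *: u k); rewrite vn => He.
  rewrite expr_div_n mulrAC ler_pdivrMr ?exprn_gt0//; apply: le_trans He _.
  rewrite mulrC -exprMn ler_pXn2r ?nnegrE ?mulr_ge0//.
  (* For the lower bound [sign_change] starts from the signed coefficients; applying the same signs
     again restores z. *)
  have c1 k : `|(-1) ^+ e k * z k| = 1 by rewrite normrM normrX normrN1 expr1n mul1r.
  have := sign_change n e c1.
  rewrite (eq_bigr (fun k : 'I_n => (-1) ^+ e k *: (z k *: u k))); last first.
    by move=> k _; rewrite scalerA.
  rewrite [X in _ <= _ * `|X|](eq_bigr (fun k : 'I_n => z k *: u k)) => [//|k _].
  by rewrite !scalerA mulrA -expr2 sqrr_sign mul1r.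
have [e] := signs_le n (fun k => z k *: u k); rewrite vn => He.
rewrite exprMn -mulrA; apply: (@le_trans _ _ ((2 * kappa) ^+ 2 *
    `|\sum_(k < n) (-1) ^+ e k *: (z k *: u k)| ^+ 2)); last first.
  by rewrite ler_pM2l// exprn_gt0.
rewrite -exprMn ler_pXn2r ?nnegrE ?mulr_ge0//.
exact: sign_change.
Qed.

End signs.

(** * Roots of unity and discrete Parseval *)

Lemma prim_root_exists (K : numClosedFieldType) n : (0 < n)%N ->
  exists z : K, n.-primitive_root z.
Proof.
pose p : {poly K} := 'X^n - 1; have [r Dp] := closed_field_poly_normal p.
move=> n_gt0; rewrite (monicP _) ?monicXnsubC // scale1r in Dp.
have rn1: all n.-unity_root r by apply/allP=> z; rewrite -root_prod_XsubC -Dp.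
have sz_r: (n < (size r).+1)%N.
  by rewrite -(size_prod_XsubC r id) -Dp size_XnsubC.
have [|z _ zn] := hasP (has_prim_root n_gt0 rn1 _ sz_r); last by exists z.
by rewrite -separable_prod_XsubC -Dp separable_Xn_sub_1 // pnatr_eq0 -lt0n.
Qed.

Lemma norm_prim_root (K : numClosedFieldType) n (z : K) :
  n.-primitive_root z -> `|z| = 1.
Proof.
move=> zn; have n0 := prim_order_gt0 zn.
apply/eqP; rewrite -(@pexpr_eq1 _ _ n)// -normrX prim_expr_order// normr1//.
Qed.

Lemma sum_unity_root (K : fieldType) n (x : K) : x ^+ n = 1 ->
  \sum_(s < n) x ^+ s = n%:R *+ (x == 1).
Proof.
move=> xn; have [->|x1] := eqVneq x 1.
  by under eq_bigr do rewrite expr1n; rewrite sumr_const card_ord.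
apply: (@mulfI _ (x - 1)); first by rewrite subr_eq0.
by rewrite -subrX1 xn subrr mulr0.
Qed.

(** Expanding the squares, the sum over s of (om^m / om^l)^s is M for m = l and 0 otherwise. *)
Lemma root_unity_parseval (K : numClosedFieldType) M (om : K) :
  M.-primitive_root om -> forall z : 'I_M -> K,
  \sum_(s < M) `|\sum_(m < M) (om ^+ s) ^+ m * z m| ^+ 2
    = M%:R * \sum_(m < M) `|z m| ^+ 2.
Proof.
move=> omM z; have om1 := norm_prim_root omM.
have om0 : om != 0 by rewrite -normr_gt0 om1.
have omC : om^* = om^-1 by rewrite (invC_norm om) om1 expr1n invr1 mul1r.
transitivity (\sum_(m < M) \sum_(l < M) z m * (z l)^* *
    \sum_(s < M) (om ^+ m / om ^+ l) ^+ s).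
  under eq_bigr => s _.
    rewrite normCK rmorph_sum mulr_suml.
    under eq_bigr => m _ do rewrite mulr_sumr.
    over.
  rewrite exchange_big; apply: eq_bigr => m _.
  rewrite exchange_big; apply: eq_bigr => l _.
  rewrite mulr_sumr; apply: eq_bigr => s _.
  rewrite rmorphM !rmorphXn /= omC expr_div_n mulrACA mulrC; congr (_ * _).
  by rewrite !exprVn -!exprM ![(s * _)%N]mulnC.
rewrite mulr_sumr; apply: eq_bigr => m _; rewrite (bigD1 m)//= [X in _ + X]big1 ?addr0.
  rewrite divff ?expf_neq0// -normCK mulrC; congr (_ * _).
  by under eq_bigr do rewrite expr1n; rewrite sumr_const card_ord.
move=> l lm; rewrite sum_unity_root; last first.
  by rewrite expr_div_n -!exprM ![(_ * M)%N]mulnC !exprM (prim_expr_order omM) !expr1n divr1.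
case: eqP => [h|]; last by rewrite mulr0n mulr0.
have : om ^+ m == om ^+ l by rewrite -(inj_eq (mulIf (invr_neq0 (expf_neq0 l om0)))) h divff ?expf_neq0.
rewrite (eq_prim_root_expr omM) !modn_small// => /eqP ml.
by move: lm; rewrite -(inj_eq val_inj) /= ml eqxx.
Qed.

(** * From flat unimodular sums to two-sided bounds for all polynomials *)

Section toeplitz.
Context (K : numClosedFieldType) (X : normedModType K).
Hypothesis transfer : quadratic_transfer X.
Variable e : int -> X.
Hypothesis shift : forall n (nu : nat -> int) (a : nat -> K) (L : int),
  `|\sum_(k < n) a k *: e (nu k + L)| = `|\sum_(k < n) a k *: e (nu k)|.

(** For exponentials in L^2(w), the Toeplitz form of w. *)
Let Phi N (a : nat -> K) := `|\sum_(k < N) a k *: e k%:Z| ^+ 2.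

(** Written as a range for m because sums over m are taken with k fixed. *)
Definition window (a : nat -> K) n m k : K := a k *+ (k <= m < k + n)%N.

Lemma sum_shifted_window (V : lmodType K) (F : nat -> V) k n M : (k + n <= M)%N ->
  \sum_(m < M) F m *+ (k <= m < k + n)%N = \sum_(i < n) F (k + i)%N.
Proof.
move=> knM; have kM : (k <= M)%N by rewrite (leq_trans _ knM)// leq_addr.
rewrite -(big_mkord xpredT (fun m => F m *+ (k <= m < k + n)%N)).
rewrite (big_cat_nat (n := k))//= (big_cat_nat (n := (k + n)%N) (m := k))//= ?leq_addr//.
rewrite big_nat_cond big1 ?add0r; last first.
  by move=> i /andP[/andP[_ ik] _]; rewrite leqNgt ik.
rewrite [X in _ + X]big_nat_cond [X in _ + X]big1 ?addr0; last first.
  by move=> i /andP[/andP[ik _] _]; rewrite [(i < _)%N]ltnNge ik andbF.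
rewrite -{1}[k]add0n big_addn addKn -(big_mkord xpredT (fun i => F (k + i)%N)).
rewrite big_nat_cond [RHS]big_nat_cond; apply: eq_bigr => i /andP[/andP[_ ik] _].
by rewrite leq_addl addnC ltn_add2l ik.
Qed.

(* In powers of z = om ^+ s, the product of P(z) = sum_k a_k z^k and
   sum_i z^i e_(n-1-i) has as coefficient of z^m a shifted copy of the part of
   sum_k a_k e_k with m - n < k <= m; now apply Parseval over the roots of unity. *)
Lemma window_sum (N n : nat) (a : nat -> K) (om : K) :
  (N + n).-primitive_root om ->
  \sum_(s < N + n) (`|\sum_(k < N) a k * (om ^+ s) ^+ k| ^+ 2 *
      `|\sum_(i < n) (om ^+ s) ^+ i *: e (n%:Z - 1 - i%:Z)| ^+ 2) =
  (N + n)%:R * \sum_(m < N + n) Phi N (window a n m).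
Proof.
move=> omM; set M := (N + n)%N.
pose q (m : nat) := \sum_(k < N) window a n m k *: e (k%:Z + (n%:Z - 1 - m%:Z)).
transitivity (\sum_(s < M) `|\sum_(m < M) (om ^+ s) ^+ m *: q m| ^+ 2).
  apply: eq_bigr => s _; move: (om ^+ s) => z.
  rewrite -exprMn -normrZ; congr (`|_| ^+ 2).
  rewrite scaler_suml.
  under [RHS]eq_bigr do rewrite scaler_sumr.
  rewrite [RHS]exchange_big; apply: eq_bigr => k _ /=.
  have kM : (k + n <= M)%N by rewrite leq_add2r ltnW.
  pose F m := (z ^+ m * a k) *: e (k%:Z + (n%:Z - 1 - m%:Z)).
  transitivity (\sum_(m < M) F m *+ (k <= m < k + n)%N); last first.
    apply: eq_bigr => m _; rewrite /window; case: (_ <= m < _)%N.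
      by rewrite !mulr1n scalerA.
    by rewrite !mulr0n scale0r scaler0.
  rewrite (sum_shifted_window F kM) scaler_sumr; apply: eq_bigr => i _.
  rewrite /F scalerA exprD; congr (_ *: e _).
  - by ring.
  - by rewrite PoszD; ring.
have := @transfer M M (fun s m => (om ^+ s) ^+ m) _ (root_unity_parseval omM) (fun m => q m).
rewrite /= => ->.
by congr (_ * _); apply: eq_bigr => m _; rewrite /q shift.
Qed.


Variables c C : K.
Hypothesis c0 : 0 < c.
Hypothesis flat : forall n (z : nat -> K), (forall k, `|z k| = 1) ->
  c * n%:R <= `|\sum_(k < n) z k *: e k%:Z| ^+ 2 <= C * n%:R.

(** In [window_sum] the second factor is bounded by [flat] at every root of unity; the remaining sum
    of |P|^2 is evaluated by Parseval. *)
Lemma window_bounds N n (a : nat -> K) : (0 < n)%N ->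
  c * n%:R * \sum_(k < N) `|a k| ^+ 2
    <= \sum_(m < N + n) Phi N (window a n m)
    <= C * n%:R * \sum_(k < N) `|a k| ^+ 2.
Proof.
move=> n0; have M0 : (0 < N + n)%N by rewrite addn_gt0 n0 orbT.
have [om omM] := prim_root_exists K M0.
have om1 := norm_prim_root omM.
have M0' : 0 < (N + n)%:R :> K by rewrite ltr0n.
rewrite -(ler_pM2l M0') -[X in _ && X](ler_pM2l M0') -(window_sum _ omM).
rewrite [_ * (c * _ * _)]mulrCA [_ * (C * _ * _)]mulrCA.
have <- : \sum_(s < N + n) `|\sum_(k < N) a k * (om ^+ s) ^+ k| ^+ 2
    = (N + n)%:R * \sum_(k < N) `|a k| ^+ 2.
  (* Parseval needs N + n coefficients, so a is padded with zeros. *)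
  have NM : (N <= N + n)%N by exact: leq_addr.
  rewrite (big_ord_widen _ (fun k => `|a k| ^+ 2) NM) [in RHS]big_mkcond /=.
  pose z (m : 'I_(N + n)) : K := if (m < N)%N then a m else 0.
  rewrite [X in _ = _ * X](eq_bigr (fun m => `|z m| ^+ 2)); last first.
    by move=> m _; rewrite /z; case: ifP => // _; rewrite normr0 expr0n.
  rewrite -(root_unity_parseval omM); apply: eq_bigr => s _; congr (`|_| ^+ 2).
  rewrite (big_ord_widen _ (fun k => a k * (om ^+ s) ^+ k) NM) big_mkcond /=.
  by apply: eq_bigr => m _; rewrite /z; case: ifP; rewrite ?mulr0// mulrC.
rewrite !mulr_sumr; have fl (s : 'I_(N + n)) :
    c * n%:R <= `|\sum_(i < n) (om ^+ s) ^+ i *: e (n%:Z - 1 - i%:Z)| ^+ 2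
      <= C * n%:R.
  (* Reversing the order gives the frequencies 0, ..., n - 1 of [flat], with coefficients still
     unimodular. *)
  have -> : \sum_(i < n) (om ^+ s) ^+ i *: e (n%:Z - 1 - i%:Z) =
     \sum_(i < n) (om ^+ s) ^+ (n - i.+1) *: e i%:Z.
    rewrite (reindex_inj rev_ord_inj); apply: eq_bigr => i _ /=.
    by congr (_ *: e _); rewrite -subzn//; rewrite intS; ring.
  by apply: (@flat n (fun i => (om ^+ s) ^+ (n - i.+1))) => k;
    rewrite !normrX om1 !expr1n.
by apply/andP; split; apply: ler_sum => s _; [rewrite mulrC|rewrite [leRHS]mulrC];
  rewrite ler_wpM2l ?exprn_ge0//; have /andP[] := fl s.
Qed.

Lemma window_id N p (a : nat -> K) m : (N <= m < N + p)%N ->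
  Phi N (window a (N + p) m) = Phi N a.
Proof.
move=> /andP[Nm mNp]; congr (`|_| ^+ 2); apply: eq_bigr => k _; congr (_ *: _).
rewrite /window (leq_trans (ltnW (ltn_ord k)) Nm) (leq_trans mNp) ?mulr1n//.
by rewrite leq_addl.
Qed.

Let sq_ge0 N (a : nat -> K) : 0 <= \sum_(k < N) `|a k| ^+ 2.
Proof. by apply: sumr_ge0 => k _; rewrite exprn_ge0. Qed.

Let cC : c <= C.
Proof.
have /andP[h1 h2] := @flat 1 (fun=> 1) (fun=> normr1 _).
by have := le_trans h1 h2; rewrite !mulr1.
Qed.

(* For N <= m < 2N, the window of length 2N keeps all the coefficients. *)
Lemma toeplitz_upper N (a : nat -> K) : Phi N a <= 2 * C * \sum_(k < N) `|a k| ^+ 2.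
Proof.
case: N => [|N]; first by rewrite /Phi !big_ord0 normr0 expr0n mulr0.
have N0 : 0 < N.+1%:R :> K by rewrite ltr0n.
rewrite -(ler_pM2l N0).
have /andP[_] := window_bounds N.+1 a (isT : 0 < N.+1 + N.+1)%N.
rewrite (_ : C * (N.+1 + N.+1)%:R * _ = N.+1%:R * (2 * C * \sum_(k < N.+1) `|a k| ^+ 2)); last first.
  by rewrite natrD; ring.
apply: le_trans.
apply: (@le_trans _ _ (\sum_(m < N.+1 + (N.+1 + N.+1)) Phi N.+1 a *+ (N.+1 <= m < N.+1 + N.+1)%N)).
  by rewrite (sum_shifted_window (fun=> Phi N.+1 a)) ?leq_addl// sumr_const card_ord mulr_natl.
apply: ler_sum => m _; have [h|_] := boolP (N.+1 <= m < N.+1 + N.+1)%N.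
  by rewrite window_id.
by rewrite mulr0n exprn_ge0.
Qed.

(* In a window of length N(r+1), all but 2N of the indices m keep every coefficient; the
   upper bound controls the others. *)
Lemma toeplitz_lower N (a : nat -> K) (r : nat) : 8 * C <= c * r%:R ->
  c / 2 * \sum_(k < N) `|a k| ^+ 2 <= Phi N a.
Proof.
case: N => [|N] cr; first by rewrite /Phi !big_ord0 normr0 expr0n mulr0.
set S := \sum_(k < _) _.
have C0 : 0 < C by exact: lt_le_trans cC.
have r0 : (0 < r)%N.
  by case: r cr => //; rewrite mulr0 => /(lt_le_trans (mulr_gt0 (ltr0n K 8) C0)); rewrite ltxx.
have N0 : 0 < N.+1%:R :> K by rewrite ltr0n.
pose p := (N.+1 * r)%N; pose D := 2 * C * S.
have D0 : 0 <= D by rewrite mulr_ge0 ?sq_ge0// mulr_ge0// ltW.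
have trunc m : Phi N.+1 (window a (N.+1 + p) m) <= D.
  apply: le_trans (toeplitz_upper _ _) _; apply: ler_wpM2l; first by rewrite mulr_ge0// ltW.
  apply: ler_sum => k _; rewrite /window; case: (_ && _); first by rewrite mulr1n.
  by rewrite mulr0n normr0 expr0n exprn_ge0.
(* Exactly p of the indices m lie in the range where the window is complete. *)
have sum_trunc : \sum_(m < N.+1 + (N.+1 + p)) Phi N.+1 (window a (N.+1 + p) m) <=
    2 * N.+1%:R * D + p%:R * Phi N.+1 a.
  apply: (@le_trans _ _ (\sum_(m < N.+1 + (N.+1 + p))
     (D + (Phi N.+1 a - D) *+ (N.+1 <= m < N.+1 + p)%N))).
    apply: ler_sum => m _; have [h|_] := boolP (N.+1 <= m < N.+1 + p)%N.
      by rewrite window_id// mulr1n [D + _]addrC subrK.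
    by rewrite mulr0n addr0.
  rewrite big_split /= (sum_shifted_window (fun=> Phi N.+1 a - D)) ?leq_addl// !sumr_const !card_ord.
  rewrite -[D *+ _]mulr_natl -[(_ - D) *+ _]mulr_natl (natrD _ N.+1 (N.+1 + p)) (natrD _ N.+1 p).
  move: (N.+1%:R) (p%:R) (Phi _ _) => x y z.
  by rewrite le_eqVlt; apply/orP; left; apply/eqP; ring.
have /andP[/le_trans/(_ sum_trunc) H _] := window_bounds N.+1 a (isT : 0 < N.+1 + p)%N.
have pr0 : 0 < N.+1%:R * r%:R :> K by rewrite mulr_gt0// ltr0n.
(* The added term is the error from the incomplete windows; by the choice of r it is at most half of
   c p S. *)
rewrite -(ler_pM2l pr0) -(lerD2l (N.+1%:R * (8 * C / 2) * S)).
have -> : N.+1%:R * (8 * C / 2) * S + N.+1%:R * r%:R * Phi N.+1 a =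
   2 * N.+1%:R * D + p%:R * Phi N.+1 a.
  by rewrite /p natrM /D; field.
apply: le_trans H; rewrite -/S.
apply: (@le_trans _ _ (N.+1%:R * (c * r%:R / 2) * S + N.+1%:R * r%:R * (c / 2 * S))).
  by rewrite lerD2r ler_wpM2r ?sq_ge0// ler_wpM2l ?ler0n// ler_wpM2r ?invr_ge0.
have -> : N.+1%:R * (c * r%:R / 2) * S + N.+1%:R * r%:R * (c / 2 * S) = c * p%:R * S.
  by rewrite /p natrM; field.
by rewrite ler_wpM2r ?sq_ge0// ler_wpM2l ?ler_nat ?leq_addl// ltW.
Qed.

End toeplitz.

(** * Real series with geometrically weighted squares *)

Lemma weighted_sum_sq (R : realFieldType) j (z : nat -> R) :
  (\sum_(i < j) z i) ^+ 2 <= \sum_(i < j) 2 ^+ i.+1 * z i ^+ 2.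
Proof.
elim: j z => [|j IH] z; first by rewrite !big_ord0 expr0n.
rewrite !big_ord_recl /=; have := IH (fun i => z i.+1).
set S := \sum_(i < j) _; set T := \sum_(i < j) _ => h.
have -> : \sum_(i < j) 2 ^+ (bump 0 i).+1 * z (bump 0 i) ^+ 2 = 2 * T.
  by rewrite /T mulr_sumr; apply: eq_bigr => i _; rewrite exprS mulrA.
rewrite expr1; have := sqr_ge0 (z 0%N - S); nra.
Qed.

(** Supplies pointwise limits in the completeness proof, with an error bound that can be
    integrated. *)
Lemma weighted_series (R : realType) (x : nat -> R) (h : R) :
  (forall n, \sum_(k < n) 2 ^+ k * x k ^+ 2 <= h) ->
  cvgn (series x) /\
  forall n, (limn (series x) - series x n) ^+ 2 <= 2 * h * 2^-1 ^+ n.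
Proof.
move=> xh.
have cx : cvgn (series x).
  apply: (@normed_cvg R R x); apply: nondecreasing_is_cvgn.
    by apply: nondecreasing_series => n _ _; exact: normr_ge0.
  exists (2 + h) => _ [n _ <-].
  (* By completing the square; it gives absolute convergence with total at most 2 + h. *)
  have x2 k : `|x k| <= 2^-1 ^+ k + 2 ^+ k * x k ^+ 2.
    have p0 : 0 < 2 ^+ k :> R by rewrite exprn_gt0.
    rewrite exprVn -[x k ^+ 2]real_normK ?num_real//.
    move: (normr_ge0 (x k)) p0; move: `|x k| (2 ^+ k) => a b a0 b0.
    rewrite -subr_ge0 (_ : _ - _ = b^-1 * ((a * b - 2^-1) ^+ 2 + 3 / 4)); last first.
      by field; rewrite gt_eqF.
    by rewrite mulr_ge0 ?invr_ge0 ?addr_ge0 ?sqr_ge0 ?ltW// divr_ge0.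
  have -> : [normed series x] n = \sum_(k < n) `|x k| by rewrite /normed_series_of seriesEord.
  apply: (@le_trans _ _ (\sum_(k < n) (2^-1 ^+ k + 2 ^+ k * x k ^+ 2))).
    by apply: ler_sum => k _; exact: x2.
  rewrite big_split/=; apply: lerD; last exact: xh.
  have := @geometric_le_lim R n 1 2^-1 ler01.
  rewrite invr_gt0 ltr0n gtr0_norm ?invr_gt0 ?ltr0n// invf_lt1 ?ltr1n// => /(_ isT isT).
  rewrite seriesEord /= (_ : 1 / (1 - 2^-1) = 2); last by field.
  by apply: le_trans; apply: ler_sum => k _; rewrite mul1r.
split=> // n.
have H m : (n <= m)%N -> (series x m - series x n) ^+ 2 <= 2 * h * 2^-1 ^+ n.
  move=> /subnKC <-; set j := (m - n)%N.
  rewrite !seriesEord /= big_split_ord /= addrAC subrr add0r.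
  apply: le_trans (weighted_sum_sq j (fun i => x (n + i)%N)) _.
  rewrite (_ : \sum_(i < j) _ =
    2 * 2^-1 ^+ n * \sum_(i < j) 2 ^+ (n + i) * x (n + i)%N ^+ 2); last first.
    rewrite mulr_sumr; apply: eq_bigr => i _.
    by rewrite exprS exprD exprVn; field; rewrite gt_eqF// exprn_gt0.
  rewrite [leRHS]mulrAC ler_pM2l ?mulr_gt0 ?exprn_gt0 ?invr_gt0//.
  apply: le_trans (xh (n + j)%N); rewrite big_split_ord /= lerDr.
  by apply: sumr_ge0 => i _; rewrite mulr_ge0 ?sqr_ge0 ?exprn_ge0.
apply: (@cvgr_to_le _ \oo _ _ (fun m => (series x m - series x n) ^+ 2)).
  by rewrite expr2; under eq_fun do rewrite expr2; apply: cvgM;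
    (apply: cvgB; [exact: cx|exact: cvg_cst]).
by exists n => // m /= /H.
Qed.

(** * Quadratic identities and completeness in L^2(w) *)

Section L2_facts.
Context (R : realType) (w : weight R).
Local Open Scope complex_scope.
Import ComplexField.Normc.
Local Notation mu := (@lebesgue_measure R).

Lemma measurable_energy_density f : measurable_complex f ->
  measurable_fun (@circle R) (fun t => ((normc (f t) ^+ 2)%:E * w t)%E).
Proof.
move=> [mr mi]; apply: emeasurable_funM; last first.
  exact: measurable_funTS (weight_measurable w).
apply/measurable_EFinP; under eq_fun do rewrite normc_sq.
by apply: measurable_funD; exact: measurable_funX.
Qed.

Lemma energy_density_ge0 (f : R -> R[i]^o) t : (0 <= (normc (f t) ^+ 2)%:E * w t)%E.
Proof. by rewrite mule_ge0 ?lee_fin ?sqr_ge0 ?weight_ge0. Qed.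

Lemma L2fun_lincomb n (a : 'I_n -> R[i]) (g : 'I_n -> L2fun w) t :
  val (\sum_i a i *: g i) t = \sum_i a i * val (g i) t.
Proof.
by rewrite (big_morph (fun f : L2fun w => val f t) (id1 := 0) (op1 := +%R)).
Qed.

Lemma L2fun_sum n (g : nat -> L2fun w) t :
  val (\sum_(i < n) g i) t = \sum_(i < n) val (g i) t.
Proof. by rewrite (big_morph (fun f : L2fun w => val f t) (id1 := 0) (op1 := +%R)). Qed.

Lemma L2class_sum n (g : nat -> L2fun w) :
  \sum_(i < n) L2class (g i) = L2class (\sum_(i < n) g i).
Proof.
rewrite (big_morph (@L2class R w) (id1 := 0) (op1 := +%R))//; first exact: L2classD.
by apply/L2class_eq0; exact: rpred0.
Qed.

Lemma L2class_lincomb n (a : 'I_n -> R[i]) (g : 'I_n -> L2fun w) :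
  \sum_i a i *: L2class (g i) = L2class (\sum_i a i *: g i).
Proof.
rewrite (big_morph (@L2class R w) (id1 := 0) (op1 := +%R)).
- by apply: eq_bigr => i _; rewrite L2classZ.
- exact: L2classD.
- by apply/L2class_eq0; exact: rpred0.
Qed.

Lemma norm_L2class (f : L2fun w) : `|L2class f| = (L2seminorm f)%:C :> R[i].
Proof. by rewrite L2_normE L2norm_class. Qed.

Lemma eq_norm_lincomb n (a : 'I_n -> R[i]) (f g : 'I_n -> L2fun w) :
  (forall t, normc (\sum_i a i * val (f i) t) = normc (\sum_i a i * val (g i) t)) ->
  `|\sum_i a i *: L2class (f i)| = `|\sum_i a i *: L2class (g i)|.
Proof.
move=> fg; rewrite !L2class_lincomb !norm_L2class; congr (_%:C).
rewrite /L2seminorm; congr (Num.sqrt (fine _)); apply: eq_integral => t _.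
by rewrite !L2fun_lincomb fg.
Qed.

Lemma normcsq (z : R[i]) : `|z| ^+ 2 = (normc z ^+ 2)%:C :> R[i].
Proof. by rewrite rmorphXn. Qed.

Lemma measurable_sum_energy_density n (G : 'I_n -> L2fun w) :
  measurable_fun (@circle R) (fun t => ((\sum_i normc (val (G i) t) ^+ 2)%:E * w t)%E).
Proof.
apply: emeasurable_funM; last exact: measurable_funTS (weight_measurable w).
apply/measurable_EFinP; apply: measurable_sum => i.
under eq_fun do rewrite normc_sq; have [mr mi] := L2fun_measurable (G i).
by apply: measurable_funD; exact: measurable_funX.
Qed.

Lemma sum_energy n (G : 'I_n -> L2fun w) :
  (\sum_i energy w (val (G i)) =
   \int[mu]_(t in @circle R) ((\sum_i normc (val (G i) t) ^+ 2)%:E * w t))%E.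
Proof.
rewrite /energy -ge0_integral_sum; last 3 first.
- exact: measurable_circle.
- by move=> i; apply: measurable_energy_density; exact: (L2fun_measurable (G i)).
- by move=> *; exact: energy_density_ge0.
apply: eq_integral => t _; rewrite -sumEFin ge0_sume_distrl//.
by move=> i _; rewrite lee_fin sqr_ge0.
Qed.

(** The scalar identity holds at each point t for representatives; integrate it against w. *)
Lemma L2_quadratic_transfer : quadratic_transfer (L2 w).
Proof.
move=> S T c lam H v.
pose g t : L2fun w := repr (v t).
pose F s := \sum_t c s t *: g t.
have vg t : v t = L2class (g t) by rewrite L2class_repr.
have normsq (f : L2fun w) : `|L2class f| ^+ 2 = (L2seminorm f ^+ 2)%:C :> R[i].
  by rewrite norm_L2class rmorphXn.
rewrite (eq_bigr (fun s => (L2seminorm (F s) ^+ 2)%:C)); last first.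
  move=> s _; rewrite -normsq -L2class_lincomb; congr (`|_| ^+ 2).
  by apply: eq_bigr => t _; rewrite vg.
rewrite [in RHS](eq_bigr (fun t => (L2seminorm (g t) ^+ 2)%:C)); last first.
  by move=> t _; rewrite vg normsq.
rewrite -!rmorph_sum -(rmorph_nat (real_complex R)) -rmorphM; congr (_%:C).
apply: EFin_inj; rewrite EFinM -!sumEFin.
under eq_bigr do rewrite L2seminorm_sq.
under [in RHS]eq_bigr do rewrite L2seminorm_sq.
rewrite !sum_energy -ge0_integralZl_EFin//; last 3 first.
- exact: measurable_circle.
- by move=> t _; rewrite mule_ge0 ?weight_ge0// lee_fin sumr_ge0// => i _; rewrite sqr_ge0.
- exact: measurable_sum_energy_density.
apply: eq_integral => t _; rewrite muleA -EFinM; congr (_%:E * _)%E.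
have csum n (z : 'I_n -> R[i]) : (\sum_i normc (z i) ^+ 2)%:C = \sum_i `|z i| ^+ 2.
  by rewrite rmorph_sum; apply: eq_bigr => i _; rewrite normcsq.
apply: (@complexI R).
have -> : (lam%:R * \sum_i normc (val (g i) t) ^+ 2)%:C =
    lam%:R * \sum_i `|val (g i) t| ^+ 2 by rewrite -csum rmorphM rmorph_nat.
rewrite (csum _ (fun s => val (F s) t)) -H.
by apply: eq_bigr => s _; rewrite L2fun_lincomb.
Qed.

(** A Riesz-Fischer argument: [H], the sum of 2^k |f_k|^2, is integrable against w, and its
    multiples 4 * 2^-n * [H] bound the squared tails of the pointwise series. *)
Lemma L2_summable (y : nat -> L2 w) : (forall n, `|y n| <= 2^-1 ^+ n) ->
  exists x : L2 w, \sum_(i < n) y i @[n --> \oo] --> x.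
Proof.
move=> y_le; pose f n : L2fun w := repr (y n).
have yf n : y n = L2class (f n) by rewrite L2class_repr.
have Ef n : (energy w (val (f n)) <= ((4^-1) ^+ n)%:E)%E.
  have := y_le n; rewrite yf norm_L2class -(rmorph_nat (real_complex R)) -fmorphV -rmorphXn lecR => h.
  rewrite -L2seminorm_sq lee_fin (_ : 4^-1 ^+ n = (2^-1 ^+ n) ^+ 2); last first.
    by rewrite -!exprM mulnC exprM; congr (_ ^+ n); field.
  by rewrite ler_pXn2r ?nnegrE ?L2seminorm_ge0 ?exprn_ge0 ?invr_ge0.
pose p n t := complex.Re (val (f n) t); pose q n t := complex.Im (val (f n) t).
have mp n : measurable_fun (@circle R) (p n) by have [] := L2fun_measurable (f n).
have mq n : measurable_fun (@circle R) (q n) by have [] := L2fun_measurable (f n).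
pose a k t : R := 2 ^+ k * (p k t ^+ 2 + q k t ^+ 2).
have a0 k t : 0 <= a k t by rewrite mulr_ge0 ?exprn_ge0// addr_ge0 ?sqr_ge0.
have ma k : measurable_fun (@circle R) (a k).
  by apply: measurable_funM => //; apply: measurable_funD; exact: measurable_funX.
pose H t := (\sum_(k <oo) (a k t)%:E)%E.
have mH : measurable_fun (@circle R) H.
  apply: (ge0_emeasurable_sum (P := xpredT)) => [k t _ _|k _]; first by rewrite lee_fin.
  by apply/measurable_EFinP; exact: ma.
have mC := @measurable_circle R.
have aw0 k t : (0 <= (a k t)%:E * w t)%E.
  by apply: mule_ge0; [rewrite lee_fin|exact: weight_ge0].
(* Here w is inside the sum, so that integration term by term gives at most the sum of 2^k 4^-k,
   which is 2. *)
pose G t := (\sum_(k <oo) ((a k t)%:E * w t))%E.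
have G2 : (\int[mu]_(t in @circle R) G t <= 2%:E)%E.
  rewrite integral_nneseries//; last first.
    by move=> k; apply: emeasurable_funM; [apply/measurable_EFinP; exact: ma|exact: measurable_funTS (weight_measurable w)].
  apply: le_trans (_ : (\sum_(k <oo) (2 / (2 ^ k.+1)%:R)%:E <= 2%:E)%E); last exact: epsilon_trick0.
  apply: lee_nneseries => [k _ _|k _].
    by apply: integral_ge0 => t _; exact: aw0.
  have -> : (\int[mu]_(t in @circle R) ((a k t)%:E * w t) = (2 ^+ k)%:E * energy w (val (f k)))%E.
    rewrite /energy -ge0_integralZl_EFin//; last 2 first.
    - by move=> t _; exact: energy_density_ge0.
    - by apply: measurable_energy_density; exact: (L2fun_measurable (f k)).
    by apply: eq_integral => t _; rewrite muleA -EFinM normc_sq.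
  apply: le_trans (lee_wpmul2l _ (Ef k)) _; first by rewrite lee_fin exprn_ge0.
  rewrite -EFinM lee_fin -exprMn natrX exprS.
  rewrite (_ : 2 * 4^-1 = 2^-1 :> R); last by field.
  by rewrite exprVn le_eqVlt; apply/orP; left; apply/eqP; field; rewrite gt_eqF// exprn_gt0.
(* The only delicate case is w t = +oo. *)
have HwG t : (H t * w t <= G t)%E.
  have [w1|w1] := boolP (w t \is a fin_num).
    rewrite -(fineK w1) muleC -nneseriesZl => [|k _]; last by rewrite lee_fin.
    by apply: lee_nneseries => [k _ _|k _]; [rewrite fineK// muleC|rewrite fineK// muleC].
  have -> : w t = +oo%E.
    by apply/eqP; move: w1; rewrite ge0_fin_numE ?weight_ge0// -leNgt leye_eq.
  have [[k ak]|na] := pselect (exists k, a k t != 0).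
    have Goo : G t = +oo%E.
      apply/eqP; rewrite -leye_eq.
      apply: le_trans (@nneseries_lim_ge _ _ xpredT 0 k.+1 (fun n _ _ => aw0 n t)).
      rewrite big_mkord big_ord_recr/=.
      have -> : ((a k t)%:E * w t = +oo)%E.
        rewrite (_ : w t = +oo%E); first by rewrite gt0_muley// lte_fin lt0r ak a0.
        by apply/eqP; move: w1; rewrite ge0_fin_numE ?weight_ge0// -leNgt leye_eq.
      by rewrite addey// gt_eqF// (lt_le_trans ltNy0)// sume_ge0// => i _; exact: aw0.
    by rewrite Goo leey.
  have -> : H t = 0%E.
    apply: eseries0 => k _ _; congr (_%:E); apply/eqP; apply: contrapT => /negP ak.
    by apply: na; exists k.
  by rewrite mul0e; apply: nneseries_ge0 => k _ _; exact: aw0.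
(* Outside U the series is replaced by 0, which makes it converge everywhere. *)
pose U := @circle R `&` [set t | (H t < +oo)%E].
have mU : measurable U by apply: (measurable_lte mC mH); exact: measurable_cst.
pose p' t k := p k t * \1_U t; pose q' t k := q k t * \1_U t.
have H0 t : (0 <= H t)%E by apply: nneseries_ge0 => k _ _; rewrite lee_fin.
pose h t := if t \in U then fine (H t) else 0.
have pqh t n : \sum_(k < n) 2 ^+ k * p' t k ^+ 2 <= h t /\
    \sum_(k < n) 2 ^+ k * q' t k ^+ 2 <= h t.
  rewrite /h /p' /q' indicE; case: ifPn => tU.
    have Hfin : H t \is a fin_num by rewrite ge0_fin_numE//; move: tU; rewrite inE => -[].
    have partial : \sum_(k < n) a k t <= fine (H t).
      rewrite -lee_fin fineK// -sumEFin -(big_mkord xpredT (fun k => (a k t)%:E)).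
      by apply: nneseries_lim_ge => k _ _; rewrite lee_fin.
    by split; (apply: le_trans partial; apply: ler_sum => k _; rewrite mulr1;
      apply: ler_wpM2l; rewrite ?exprn_ge0// ?lerDl ?lerDr sqr_ge0).
  by split; rewrite big1// => k _; rewrite mulr0 expr0n mulr0.
have Pc t := weighted_series (fun n => (pqh t n).1).
have Qc t := weighted_series (fun n => (pqh t n).2).
pose F (t : R) : R[i]^o := limn (series (p' t)) +i* limn (series (q' t)).
have mF : measurable_complex F.
  split; [apply: (measurable_fun_cvg (h := fun n t => series (p' t) n))|
          apply: (measurable_fun_cvg (h := fun n t => series (q' t) n))].
  - move=> m; rewrite /series /=; apply: measurable_sum => k.
    by apply: measurable_funM => //; exact: measurable_indic.
  - by move=> t _; exact: (Pc t).1.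
  - move=> m; rewrite /series /=; apply: measurable_sum => k.
    by apply: measurable_funM => //; exact: measurable_indic.
  - by move=> t _; exact: (Qc t).1.
pose S n : L2fun w := \sum_(i < n) f i.
have ReS n t : complex.Re (val (S n) t) = \sum_(k < n) p k t.
  by rewrite L2fun_sum raddf_sum.
have ImS n t : complex.Im (val (S n) t) = \sum_(k < n) q k t.
  by rewrite L2fun_sum raddf_sum.
(* On [U] the real and imaginary parts contribute 2 * 2^-n * [H] each; elsewhere on the circle the
   bound is +oo. *)
have FS n t : @circle R t ->
    ((normc (F t - val (S n) t) ^+ 2)%:E <= (4 * 2^-1 ^+ n)%:E * H t)%E.
  move=> Ct; have [tU|tU] := boolP (t \in U); last first.
    have -> : H t = +oo%E.
      apply/eqP; rewrite -leye_eq leNgt; apply: contra tU => Hoo; rewrite inE; split => //.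
    by rewrite gt0_muley ?leey// lte_fin mulr_gt0 ?exprn_gt0 ?invr_gt0.
  have Hfin : H t \is a fin_num by rewrite ge0_fin_numE//; move: tU; rewrite inE => -[].
  rewrite -(fineK Hfin) -EFinM lee_fin normc_sq.
  have -> : complex.Re (F t - val (S n) t) = limn (series (p' t)) - series (p' t) n.
    rewrite raddfB/= ReS seriesEord/=; congr (_ - _); apply: eq_bigr => k _.
    by rewrite /p' indicE tU mulr1.
  have -> : complex.Im (F t - val (S n) t) = limn (series (q' t)) - series (q' t) n.
    rewrite raddfB/= ImS seriesEord/=; congr (_ - _); apply: eq_bigr => k _.
    by rewrite /q' indicE tU mulr1.
  have hE : h t = fine (H t) by rewrite /h tU.
  have := (Pc t).2 n; have := (Qc t).2 n; rewrite hE; lra.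
have mFS n : measurable_complex (F - val (S n)).
  rewrite -scaleN1r; apply: measurable_complexD => //.
  exact/measurable_complexZ/L2fun_measurable.
have EFS n : (energy w (F - val (S n))%R <= (8 * 2^-1 ^+ n)%:E)%E.
  have c0 : 0 <= 4 * 2^-1 ^+ n :> R by rewrite mulr_ge0 ?exprn_ge0 ?invr_ge0.
  have mG : measurable_fun (@circle R) G.
    apply: (ge0_emeasurable_sum (P := xpredT)) => [k t _ _|k _]; first exact: aw0.
    by apply: emeasurable_funM; [apply/measurable_EFinP; exact: ma|
      exact: measurable_funTS (weight_measurable w)].
  have G0 t : (0 <= G t)%E by apply: nneseries_ge0 => k _ _; exact: aw0.
  apply: (@le_trans _ _ (\int[mu]_(t in @circle R) ((4 * 2^-1 ^+ n)%:E * G t))%E).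
    apply: ge0_le_integral => //.
    - by move=> t _; exact: energy_density_ge0.
    - exact: measurable_energy_density (mFS n).
    - by apply: emeasurable_funM.
    - move=> t Ct; apply: (@le_trans _ _ ((4 * 2^-1 ^+ n)%:E * H t * w t)%E).
        by apply: lee_wpmul2r; [exact: weight_ge0|exact: FS].
      by rewrite -muleA lee_wpmul2l// lee_fin.
  rewrite ge0_integralZl_EFin//.
  apply: (@le_trans _ _ ((4 * 2^-1 ^+ n)%:E * 2%:E)%E); first by rewrite lee_wpmul2l// lee_fin.
  by rewrite -EFinM lee_fin; lra.
have FL2 : F \in inL2 w.
  (* The partial sum of index 0 vanishes, so this bounds the energy of F itself. *)
  apply/inL2P; split => //; have := EFS 0%N.
  rewrite /S big_ord0 (_ : F - val 0 = F); last by rewrite subr0.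
  by move=> /le_lt_trans; apply; rewrite ltry.
pose Fx : L2fun w := exist _ F FL2.
exists (L2class Fx); apply/cvgrPdist_le => -[e1 e2].
rewrite ltcE /= => /andP[/eqP -> e0].
have /cvgrPdist_lt /(_ _ (exprn_gt0 2 e0)) : geometric 8 2^-1 @ \oo --> (0 : R).
  by apply: cvg_geometric; rewrite gtr0_norm ?invr_gt0// invf_lt1// ltr1n.
apply: filterS => n.
rewrite sub0r normrN ger0_norm ?mulr_ge0 ?exprn_ge0 ?invr_ge0// => n8.
rewrite (eq_bigr (fun i : 'I_n => L2class (f i))) => [|i _]; last exact: yf.
rewrite L2class_sum -/(S n).
have -> : L2class Fx - L2class (S n) = L2class (Fx - S n).
  by apply/eqP; rewrite subr_eq -L2classD subrK.
rewrite norm_L2class (lecR _ e1).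
rewrite -(ler_pXn2r (isT : (0 < 2)%N)) ?nnegrE ?L2seminorm_ge0 ?(ltW e0)//.
by rewrite -lee_fin L2seminorm_sq (le_trans (EFS n))// lee_fin ltW.
Qed.

End L2_facts.

Lemma sum_injective_reindex (K : numDomainType) (V : lmodType K) n N
    (tau : 'I_n -> 'I_N) (a : 'I_n -> K) (u : 'I_N -> V) : injective tau ->
  exists a' : 'I_N -> K,
    \sum_k a k *: u (tau k) = \sum_j a' j *: u j /\
    \sum_k `|a k| ^+ 2 = \sum_j `|a' j| ^+ 2.
Proof.
move=> inj; exists (fun j => \sum_(k | tau k == j) a k); split.
  rewrite (partition_big tau xpredT)//=; apply: eq_bigr => j _.
  by rewrite scaler_suml; apply: eq_bigr => k /eqP ->.
rewrite (partition_big tau xpredT)//=; apply: eq_bigr => j _.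
case: (pickP (fun k => tau k == j)) => [k0 /eqP k0j|no]; last first.
  by rewrite !big_pred0// normr0 expr0n.
have tauE k : (tau k == j) = (k == k0) by rewrite -k0j (inj_eq inj).
by rewrite (big_pred1 k0 tauE) (big_pred1 k0 tauE).
Qed.

(** * Frequencies, positions and shifts of the trigonometric system *)

Section trigonometric.
Context (R : realType).

(** Inverse of [trig_index]; [Negz n] stands for -(n + 1). *)
Definition trig_rank (k : int) : nat :=
  match k with Posz n => n.*2 | Negz n => n.*2.+1 end.

Lemma trig_rankK k : trig_index (trig_rank k) = k.
Proof.
case: k => n; rewrite /trig_index /=.
  by rewrite -signr_odd odd_double expr0 mul1r uphalf_double.
by rewrite -signr_odd /= odd_double expr1 mulN1r doubleK NegzE.
Qed.

Lemma trig_indexK k : trig_rank (trig_index k) = k.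
Proof.
rewrite -{2}[k]odd_double_half /trig_index -signr_odd uphalf_half.
case: (odd k); rewrite ?expr0 ?mul1r ?add0n//.
by rewrite expr1 mulN1r add1n -NegzE.
Qed.

Lemma trig_index_abs k : (`|trig_index k| <= k)%N.
Proof.
rewrite /trig_index abszM abszX exp1n mul1n /= uphalf_half.
by rewrite -{3}[k]odd_double_half leq_add2l -addnn leq_addl.
Qed.

Local Open Scope complex_scope.
Import ComplexField.Normc.

Lemma trigD (k l : int) (t : R) :
  trig (k + l) t = (cos (l%:~R * t) +i* sin (l%:~R * t)) * trig k t.
Proof.
rewrite /trig intrD [(k%:~R + l%:~R) * t]mulrDl cosD sinD mulrCA; congr (_ * _).
by apply/eqP; rewrite eq_complex /=; apply/andP; split; apply/eqP; ring.
Qed.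

Lemma normc_cis (x : R) : normc (cos x +i* sin x) = 1.
Proof. by rewrite /= cos2Dsin2 sqrtr1. Qed.

Context (w : weight R).
Variable h : forall k, trig (trig_index k) \in inL2 w.
Local Notation b := (trig_system h).

Definition trig_class (k : int) : L2 w := b (trig_rank k).

(** Both sums have the same modulus at every t, as they differ by the factor e^(iLt). *)
Lemma trig_class_shift n (nu : nat -> int) (a : nat -> R[i]) (L : int) :
  `|\sum_(k < n) a k *: trig_class (nu k + L)| = `|\sum_(k < n) a k *: trig_class (nu k)|.
Proof.
pose f (m : nat) : L2fun w := exist (fun g => g \in inL2 w) _ (h m).
have := @eq_norm_lincomb R w n (fun k => a k) (fun k => f (trig_rank (nu k + L)))
  (fun k => f (trig_rank (nu k))).
apply => t; rewrite /= [X in normc X = _](_ : _ = (cos (L%:~R * t) +i* sin (L%:~R * t)) *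
    \sum_(k < n) a k * trig (trig_index (trig_rank (nu k))) t).
  by rewrite normcM normc_cis mul1r.
by rewrite mulr_sumr; apply: eq_bigr => k _; rewrite !trig_rankK trigD mulrCA.
Qed.

End trigonometric.

(** * Riesz bounds and density for the trigonometric system *)

Theorem corollary3p6 (R : realType) (w : weight R)
    (w_pos : {ae lebesgue_measure, forall t : R, (0 < w t)%E})
    (trig_L2 : forall k : nat, trig (trig_index k) \in inL2 w) :
  quasi_greedy_basis (trig_system trig_L2) -> riesz_basis (trig_system trig_L2).
Proof.
move=> [[schauder _] [bs [dual greedy]]].
pose b := trig_system trig_L2; pose e := trig_class trig_L2.
have shift := trig_class_shift trig_L2.
have shiftu n (a : nat -> R[i]) L :
    `|\sum_(k < n) a k *: b (k + L).*2| = `|\sum_(k < n) a k *: b k.*2|.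
  exact: (shift n (fun k => Posz k) a (Posz L)).
have [kappa [kappa0 suppress]] := quasi_greedy_suppression dual greedy
  (@L2_summable R w) double_inj shiftu.
have transfer := @L2_quadratic_transfer R w.
have e_norm k : `|e k| = `|e 0|.
  have := shift 1%N (fun=> 0) (fun=> 1) k.
  by rewrite !big_ord_recl !big_ord0 !addr0 !scale1r add0r.
have nu0 : 0 < `|e 0|.
  rewrite normr_gt0; apply/eqP => e0; have := dual.2 0%N 0%N.
  rewrite (_ : trig_system trig_L2 0%N = 0); last exact: e0.
  by rewrite linear0 eqxx => /eqP; rewrite eq_sym oner_eq0.
have flat := unimodular_sum_bounds transfer kappa0 nu0 (fun k => e_norm (Posz k)) suppress.
set c := (_ / _) ^+ 2 in flat; set C := (_ * _) ^+ 2 in flat.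
have c0 : 0 < c by rewrite exprn_gt0// divr_gt0// mulr_gt0.
have C0 : 0 < C by rewrite exprn_gt0// mulr_gt0// mulr_gt0.
have [r rP] : exists r : nat, 8 * C <= c * r%:R.
  have x0 : 0 <= 8 * C / c by rewrite ltW// divr_gt0// mulr_gt0.
  (* The nonnegative complex number 8C / c equals its modulus, to which the Archimedean property of
     [R] applies. *)
  exists (Num.bound (Normc.normc (8 * C / c))).
  rewrite mulrC [leRHS]mulrC -ler_pdivrMr// [C * 8]mulrC -{1}(ger0_norm x0) {x0}.
  move: (8 * C / c) => x; have n0 : 0 <= Normc.normc x by case: x => ? ?; exact: sqrtr_ge0.
  by have := archi_boundP n0; rewrite -ltcR rmorph_nat => /ltW.
have bounds n (a : nat -> R[i]) : c / 2 * \sum_(k < n) `|a k| ^+ 2 <=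
    `|\sum_(k < n) a k *: b k| ^+ 2 <= 2 * C * \sum_(k < n) `|a k| ^+ 2.
  (* The first n frequencies have absolute value at most n; shifting by n puts them into 0, ..., 2n
     without changing the norm. *)
  pose tau k := absz (trig_index k + n%:Z).
  have tauE (k : 'I_n) : Posz (tau k) = trig_index k + n%:Z.
    by have := trig_index_abs k; have := ltn_ord k; rewrite /tau; lia.
  have tauN (k : 'I_n) : (tau k < (n + n).+1)%N.
    by have := trig_index_abs k; have := ltn_ord k; have := tauE k; lia.
  pose tau' (k : 'I_n) := Ordinal (tauN k).
  have tau_inj : injective tau'.
    move=> k l /(congr1 (fun j => Posz (val j))) /=; rewrite !tauE => /addIr kl.
    by apply: val_inj; rewrite /= -(trig_indexK k) kl trig_indexK.
  have [a' [a'sum a'sq]] := sum_injective_reindex (fun k => a k) (fun j => e (Posz (val j))) tau_inj.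
  have -> : `|\sum_(k < n) a k *: b k| = `|\sum_(j < (n + n).+1) a' j *: e (Posz j)|.
    rewrite -a'sum; transitivity `|\sum_(k < n) a k *: e (trig_index k)|.
      by congr (`|_|); apply: eq_bigr => k _; rewrite /e /trig_class trig_indexK.
    rewrite -(shift n trig_index a n%:Z); congr (`|_|).
    by apply: eq_bigr => k _ /=; rewrite tauE.
  rewrite a'sq.
  pose z (j : nat) := a' (inord j).
  have zE (j : 'I_(n + n).+1) : a' j = z j by rewrite /z inord_val.
  rewrite (eq_bigr (fun j : 'I_(n + n).+1 => `|z j| ^+ 2)) => [|j _]; last by rewrite zE.
  rewrite (eq_bigr (fun j : 'I_(n + n).+1 => z j *: e (Posz j))) => [|j _]; last by rewrite zE.
  by rewrite (toeplitz_lower transfer shift c0 flat _ _ rP) (toeplitz_upper transfer shift flat).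
split.
  (* Density: partial sums of the Schauder expansion enter every neighbourhood of x. *)
  move=> O [x Ox] openO; have [a [ax _]] := schauder x.
  have [N _ /(_ N (leqnn N)) ON] := ax _ (open_nbhs_nbhs (conj openO Ox)).
  by exists (\sum_(k < N) a k *: b k); split=> //; exists N, a.
exists (c / 2), (2 * C); split=> //; first by rewrite divr_gt0.
have /andP[h1 h2] := bounds 1%N (fun=> 1).
by have := le_trans h1 h2; rewrite big_ord1 normr1 expr1n !mulr1.
Qed.
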